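(* Let $X$ be a vector field on $\mathbb{P}^2_{\mathbb{C}}$ and let $d$ be a positive integer. Then $X$ admits a first integral of degree $d$ but does not admit a first integral of degree smaller than $d$ if and only if $\mathcal{E}_d(X)=0$ and $\mathcal{E}_{d-1}(X)\neq 0$.
   Context: A vector field $X$ on $\mathbb{P}^2_{\mathbb{C}}$ is represented by a vector field $X=A\frac{\partial}{\partial x}+B\frac{\partial}{\partial y}+C\frac{\partial}{\partial z}$ on $\mathbb{C}^3$ whose coefficients are homogeneous polynomials of the same degree, inducing via the radial projection a field of directions on $\mathbb{P}^2_{\mathbb{C}}$ (so $X$ is not a multiple of the radial field $R=x\frac{\partial}{\partial x}+y\frac{\partial}{\partial y}+z\frac{\partial}{\partial z}$); two homogeneous vector fields whose difference is a multiple of $R$ represent the same vector field on $\mathbb{P}^2_{\mathbb{C}}$. Extactic curves: for $n\ge 0$ let $v_1,\dots,v_N$, $N=\binom{n+2}{2}$, be a basis (e.g. the monomials) of the space of homogeneous polynomials of degree $n$ in $x,y,z$. Then $\mathcal{E}_n(X)=\det\big(X^{i}(v_j)\big)_{0\le i\le N-1,\ 1\le j\le N}$, where $X$ acts as a derivation, $X^0(f)=f$ and $X^k(f)=X(X^{k-1}(f))$. It is a homogeneous polynomial, well defined up to a nonzero constant. A first integral of degree $d$ is a non-constant rational function $P/Q$, with $P,Q$ coprime homogeneous polynomials in $x,y,z$ of degree $d$, such that $X(P/Q)=0$. *)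

(* Defs.v *)
From mathcomp Require Import all_boot all_order all_algebra fraction.
From mathcomp Require Import reals complex.
From mathcomp Require Export mpoly.
From mathcomp Require Import generic_quotient ring.

Set Implicit Arguments.
Unset Strict Implicit.
Unset Printing Implicit Defensive.

Import GRing.Theory.
Local Open Scope ring_scope.
Local Open Scope quotient_scope.

(* The field of complex numbers is [R[i]] for a model [R : realType] of the
   real numbers; the homogeneous coordinates x, y, z are 'X_0, 'X_1, 'X_2. *)
Notation CC R := (complex R).
Notation poly3 R := {mpoly (CC R)[3]}.
Notation ratfun3 R := {fraction poly3 R}.
Local Notation "x %:F" := (@FracField.tofrac _ x).

(* A representative on C^3, with coefficients [A, B, C = coef 0, coef 1, coef 2],
   of a vector field on P^2.  Its coefficients are homogeneous of one degree
   (the zero polynomial is homogeneous of every degree), and it is not a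
   polynomial multiple of the radial field; in particular it is nonzero. *)
Record vfieldP2 (R : realType) := VFieldP2 {
  coef : 'I_3 -> poly3 R;
  vdeg : nat;
  coef_homog : forall i, coef i \is vdeg.-homog;
  coef_nradial : ~ exists f : poly3 R, forall i, coef i = f * 'X_i
}.

Definition vder (R : realType) (X : vfieldP2 R) (f : poly3 R) : poly3 R :=
  \sum_(i < 3) coef X i * f^`M(i).

(* The extension of [vder X] to rational functions by the quotient rule;
   [vderF_frac] shows that it does not depend on the chosen fraction. *)
Definition vderF (R : realType) (X : vfieldP2 R) (f : ratfun3 R) : ratfun3 R :=
  let P := \n_(repr f) in let Q := \d_(repr f) in
  (vder X P * Q - P * vder X Q)%:F / (Q ^+ 2)%:F.

Definition coprime_mpoly (R : realType) (P Q : poly3 R) : Prop :=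
  forall D P' Q' : poly3 R, P = D * P' -> Q = D * Q' -> D \is a GRing.unit.

Definition has_first_integral (R : realType) (X : vfieldP2 R) (d : nat) : Prop :=
  exists P Q : poly3 R,
    [/\ P \is d.-homog, Q \is d.-homog, Q != 0 & coprime_mpoly P Q] /\
    (~ exists c : CC R, P%:F / Q%:F = (c%:MP)%:F :> ratfun3 R) /\
    vderF X (P%:F / Q%:F) = 0.

(* The extactic determinant E_n(X) computed in the basis [v] of the space
   of homogeneous polynomials of degree [n]. *)
Definition extactic (R : realType) (X : vfieldP2 R) (n : nat)
    (v : 'C(n + 2, 2).-tuple (dhomog 3 (CC R) n)) : poly3 R :=
  \det (\matrix_(i < 'C(n + 2, 2), j < 'C(n + 2, 2))
          iter i (vder X) (tnth v j : poly3 R)).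

(* Tuples of this length which are bases do exist. *)
Lemma dim_dhomog3 (R : realType) (n : nat) :
  \dim {:dhomog 3 (CC R) n} = 'C(n + 2, 2).
Proof.
by rewrite dimvf /dim /= -(bin_sub (leq_addl n 2)) addnK.
Qed.

Lemma vderM (R : realType) (X : vfieldP2 R) (f g : poly3 R) :
  vder X (f * g) = vder X f * g + f * vder X g.
Proof.
rewrite /vder mulr_suml mulr_sumr -big_split /=; apply: eq_bigr => i _.
by rewrite mderivM; ring.
Qed.

Lemma frac_cross (D : idomainType) (p q : D) :
  q != 0 ->
  let f : {fraction D} := p%:F / q%:F in
  p * \d_(repr f) = \n_(repr f) * q.
Proof.
move=> q0 f.
have fr : f = \pi_({fraction D}) (Ratio p q).
  have qV : q%:F^-1 = \pi_({fraction D}) (Ratio 1 q).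
    rewrite -[LHS]/(FracField.inv _) !piE /FracField.invf.
    by rewrite !numden_Ratio ?oner_eq0.
  rewrite /f qV -[LHS]/(FracField.mul _ _) !piE /FracField.mulf.
  by rewrite !numden_Ratio ?oner_eq0 // mulr1 mul1r.
have := FracField.equivf_r (Ratio p q); rewrite -fr !numden_Ratio // => ->.
by rewrite mulrC.
Qed.

Lemma quotient_rule_cross (D : idomainType) (P Q N M p q n m : D) :
  Q != 0 -> M != 0 -> P * M = N * Q -> p * M + P * m = n * Q + N * q ->
  (n * M - N * m)%:F / (M ^+ 2)%:F
  = (p * Q - P * q)%:F / (Q ^+ 2)%:F :> {fraction D}.
Proof.
move=> Q0 M0 E E'; apply/eqP.
rewrite eqr_div ?tofrac_eq0 ?expf_neq0 // -!tofracM tofrac_eq; apply/eqP.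
have -> : (n * M - N * m) * Q ^+ 2 = (n * Q) * (M * Q) - (N * Q) * (m * Q).
  by ring.
have -> : n * Q = p * M + P * m - N * q by rewrite E' addrK.
have -> : (p * M + P * m - N * q) * (M * Q)
  = (p * M + P * m) * (M * Q) - (N * Q) * (q * M) by ring.
by rewrite -E; ring.
Qed.

Lemma vderF_frac (R : realType) (X : vfieldP2 R) (P Q : poly3 R) :
  Q != 0 ->
  vderF X (P%:F / Q%:F) = (vder X P * Q - P * vder X Q)%:F / (Q ^+ 2)%:F.
Proof.
move=> Q0; rewrite /vderF; have := frac_cross P Q0; cbv zeta.
move: (denom_ratioP (repr (P%:F / Q%:F : ratfun3 R))).
move: (\n_(repr _)) (\d_(repr _)) => N M M0 E.
have E' : vder X P * M + P * vder X M = vder X N * Q + N * vder X Q.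
  by rewrite -!vderM E.
exact: (quotient_rule_cross Q0 M0 E E').
Qed.

(* Main.v *)
Require Import Defs.
From mathcomp Require Import all_boot all_order all_algebra reals complex mpoly.
From mathcomp Require Import fraction generic_quotient polyXY ring.
From mathcomp Require boolp.
From HB Require Import structures.

Set Implicit Arguments.
Unset Strict Implicit.
Unset Printing Implicit Defensive.

Import GRing.Theory Num.Theory.
Local Open Scope ring_scope.
Local Open Scope quotient_scope.
Local Notation "x %:F" := (@FracField.tofrac _ x).

(** The theorem follows from one equivalence, [extactic_eq0P]: the extactic
    determinant of order n vanishes exactly when X has a first integral of
    degree at most n.

    Let P / Q be a first integral of degree e <= n, and let z be a coordinate.
    Then z^(n-e) P - (P / Q) z^(n-e) Q = 0 is a nontrivial linear relation
    between the basis elements, with coefficients that X annihilates; so it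
    holds between the columns of the extactic matrix
    ([pencil_extactic0]).

    Conversely, suppose that the determinant vanishes.  The field z X - C R,
    where R is the radial field and C the last component of X, annihilates z,
    so it descends to a polynomial vector field on the chart z = 1.  By Euler's
    identity, passing from X to this field multiplies the extactic matrix by a
    matrix of polynomials, so its determinant vanishes too ([det_chart]).  This
    is a Wronskian; its vanishing gives a linear relation over the field k of
    rational functions on the plane that the field annihilates
    ([wronskian_dependence]): a nonzero polynomial over k, of total degree at
    most n, that vanishes at the point (x, y).

    If the field annihilates x, then x itself is a first integral.  Otherwise x
    is transcendental over k, and the polynomials over k vanishing at (x, y)
    are the multiples of a single one, G ([ev2_principal]).  The total degree
    of G is at most n, and applying the field to G, with its coefficients kept
    constant, gives a polynomial that vanishes at (x, y) again: it is a
    multiple L G.  The coefficients of G and L are functions of a point p of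
    the plane, so G = G(p, q) and L = L(p, q) with q = (X, Y), and the identity
    says that for each p the curve G(p, .) = 0 is invariant, with cofactor
    L(p, .).  The point is that L does not depend on p on a generic line.
    Indeed, with s a parameter on the line and denominators cleared, the
    identity reads a(s) (D G)(s, q) = L(s, q) G(s, q); at a root of a, either L
    or G vanishes for all q, so a linear factor can be cancelled; once a is
    constant, comparing degrees in s leaves no room for s in L
    ([const_cofactor]).  Hence the coefficients of G in s are polynomials in q
    of degree at most n with a common cofactor, and the quotient of two of them
    is annihilated by the field.  On a suitable line two of them are not
    proportional, since otherwise the ratios of the coefficients of G would be
    complex constants and x, y would satisfy a polynomial relation over the
    complex numbers ([independent_coefficients], [cofactor_pencil]).

    Homogenising gives two forms of degree n with a quotient that X
    annihilates.  Coprimality comes from taking the least possible degree: a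
    common factor could be removed ([minimal_pencil_coprime]). *)

(** * Derivations and the Wronskian criterion *)
Record derivation (R : comNzRingType) (D : R -> R) : Prop := Derivation {
  derD : {morph D : f g / f + g};
  derM : forall f g, D (f * g) = D f * g + f * D g }.

Section DerivationTheory.
Variables (R : comNzRingType) (D : R -> R).
Hypothesis der : derivation D.

Lemma der0 : D 0 = 0.
Proof. by apply: (addrI (D 0)); rewrite -(derD der) !addr0. Qed.

Lemma derN f : D (- f) = - D f.
Proof. by apply: (addrI (D f)); rewrite -(derD der) !subrr der0. Qed.

Lemma derB f g : D (f - g) = D f - D g.
Proof. by rewrite (derD der) derN. Qed.

Lemma der1 : D 1 = 0.
Proof.
by apply: (addrI (D 1)); rewrite -[in RHS](mulr1 1) (derM der) mulr1 mul1r addr0.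
Qed.

Lemma der_sum I (r : seq I) (P : pred I) (F : I -> R) :
  D (\sum_(i <- r | P i) F i) = \sum_(i <- r | P i) D (F i).
Proof. exact: (big_morph D (derD der) der0). Qed.

End DerivationTheory.

Section FractionDerivation.
Variables (S : idomainType) (delta : S -> S).
Hypothesis der : derivation delta.

Lemma fracE (f : {fraction S}) : exists p q : S, q != 0 /\ f = p%:F / q%:F.
Proof.
elim/quotW: f => r; exists \n_r, \d_r; split; first exact: denom_ratioP.
have qV : (\d_r)%:F^-1 = \pi_({fraction S}) (Ratio 1 \d_r).
  rewrite -[LHS]/(FracField.inv _) !piE /FracField.invf.
  by rewrite !numden_Ratio ?oner_eq0.
rewrite qV -[RHS]/(FracField.mul _ _) !piE /FracField.mulf.
by rewrite !numden_Ratio ?oner_eq0 ?denom_ratioP // mulr1 mul1r Ratio_numden.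
Qed.

(** The quotient rule applied to a representative of the fraction; [fracderE]
    shows that the representative does not matter. *)
Definition fracder (f : {fraction S}) : {fraction S} :=
  let p := \n_(repr f) in let q := \d_(repr f) in
  (delta p * q - p * delta q)%:F / (q ^+ 2)%:F.

Lemma fracderE p q : q != 0 ->
  fracder (p%:F / q%:F) = (delta p * q - p * delta q)%:F / (q ^+ 2)%:F.
Proof.
move=> q0; rewrite /fracder; have := frac_cross p q0; cbv zeta.
move: (denom_ratioP (repr (p%:F / q%:F))).
move: (\n_(repr _)) (\d_(repr _)) => N M M0 E.
have E' : delta p * M + p * delta M = delta N * q + N * delta q.
  by rewrite -!(derM der) E.
exact: (quotient_rule_cross q0 M0 E E').
Qed.

Lemma fracder_tofrac p : fracder p%:F = (delta p)%:F.
Proof.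
rewrite -[X in fracder X]divr1 -tofrac1 fracderE ?oner_eq0 //.
by rewrite (der1 der) expr1n tofrac1 divr1 mulr1 mulr0 subr0.
Qed.

Lemma fracder_derivation : derivation fracder.
Proof.
have e2 (q : S) : q != 0 -> q%:F != 0 by rewrite tofrac_eq0.
split=> [f g|f g]; have [p [q [q0 ->]]] := fracE f;
  have [r [s [s0 ->]]] := fracE g.
- have -> : p%:F / q%:F + r%:F / s%:F = (p * s + r * q)%:F / (q * s)%:F.
    by rewrite addf_div ?e2 // -!tofracM -tofracD.
  rewrite !fracderE ?mulf_neq0 // addf_div ?e2 ?expf_neq0 //.
  rewrite -!tofracM -tofracD; apply/eqP.
  rewrite eqr_div ?e2 ?mulf_neq0 ?expf_neq0 ?mulf_neq0 // -!tofracM tofrac_eq.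
  by rewrite (derD der) !(derM der); apply/eqP; ring.
- rewrite mulf_div -!tofracM !fracderE ?mulf_neq0 // !mulf_div -!tofracM.
  rewrite addf_div ?e2 ?mulf_neq0 ?expf_neq0 //.
  rewrite -!tofracM -tofracD; apply/eqP.
  rewrite eqr_div ?e2 ?mulf_neq0 ?expf_neq0 ?mulf_neq0 ?expf_neq0 //.
  rewrite -!tofracM tofrac_eq.
  by rewrite !(derM der); apply/eqP; ring.
Qed.

End FractionDerivation.

Section Wronskian.
Variables (F : fieldType) (D : F -> F).
Hypothesis der : derivation D.

Lemma iter_derS i f : D (iter i D f) = iter i.+1 D f. Proof. by []. Qed.

(** Take n minimal with a vanishing determinant and normalise the last
    coefficient of the relation between the columns to 1.  Differentiating the
    relation gives one between the other columns with coefficients [D (c j)], which must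
    all be zero. *)
Lemma wronskian_dependence n (u : nat -> F) :
  \det (\matrix_(i < n, j < n) iter i D (u j)) = 0 ->
  exists c : nat -> F, [/\ forall j, D (c j) = 0, exists2 j, (j < n)%N & c j != 0
    & \sum_(j < n) c j * u j = 0].
Proof.
elim: n => [|n IHn]; first by rewrite det_mx00 => /eqP; rewrite oner_eq0.
set W := \matrix_(i < n, j < n) iter i D (u j) in IHn.
have [/IHn [c [Dc [j jn cj] cu]] _|Wn0] := eqVneq (\det W) 0.
  exists (fun j => if (j < n)%N then c j else 0); split.
  - by move=> i; case: ifP => // _; apply: der0.
  - by exists j; [apply: ltnW|rewrite jn].
  - rewrite big_ord_recr /= ltnn mul0r addr0 -[RHS]cu.
    by apply: eq_bigr => i _; rewrite ltn_ord.
(* Independence of the shorter columns, as det W is nonzero. *)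
have killW (b : nat -> F) :
    (forall i, (i < n)%N -> \sum_(j < n) b j * iter i D (u j) = 0) ->
    forall j, (j < n)%N -> b j = 0.
  move=> bW j jn; apply/eqP/negPn/negP => bj; case/negP: Wn0.
  rewrite -det_tr; apply/det0P; exists (\row_i b i).
    by apply: contra_neq bj => /rowP/(_ (Ordinal jn)); rewrite !mxE.
  apply/rowP=> i; rewrite !mxE -[RHS](bW i) //.
  by apply: eq_bigr => l _; rewrite !mxE.
rewrite -det_tr => /eqP/det0P [v v0 vW].
pose b j := if insub j is Some i then v 0 (i : 'I_n.+1) else 0.
have bE (i : 'I_n.+1) : b i = v 0 i by rewrite /b valK.
have bW i : (i < n.+1)%N -> \sum_(j < n.+1) b j * iter i D (u j) = 0.
  move=> iltn; move/rowP/(_ (Ordinal iltn)): vW; rewrite !mxE => vW.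
  by rewrite -[RHS]vW; apply: eq_bigr => j _; rewrite !mxE bE.
have bn : b n != 0.
  apply: contraNneq v0 => bn0; apply/eqP/rowP=> j; rewrite mxE -bE.
  have := ltn_ord j; rewrite ltnS leq_eqVlt => /predU1P[->//|jn].
  apply: (killW b) jn => k kn; rewrite -[RHS](bW k (leqW kn)).
  by rewrite big_ord_recr /= bn0 mul0r addr0.
pose c j := b j / b n.
have cW i : (i < n.+1)%N -> \sum_(j < n.+1) c j * iter i D (u j) = 0.
  move=> ilt; transitivity ((\sum_(j < n.+1) b j * iter i D (u j)) / b n).
    by rewrite mulr_suml; apply: eq_bigr => j _; rewrite /c mulrAC.
  by rewrite bW // mul0r.
have cn : c n = 1 by rewrite /c divff.
have Dcn : D (c n) = 0 by rewrite cn (der1 der).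
have Dc j : (j < n)%N -> D (c j) = 0.
  apply: (killW (fun l => D (c l))) => i ilt.
  have /(congr1 D) := cW i (leqW ilt).
  rewrite (der_sum der) (der0 der).
  under eq_bigr => l _ do rewrite (derM der) iter_derS.
  rewrite big_split.
  rewrite (cW i.+1) //= addr0 big_ord_recr /=.
  by rewrite Dcn mul0r addr0.
exists (fun j => if (j < n.+1)%N then c j else 0); split.
- move=> j; case: ifP => [|_]; last exact: der0.
  by rewrite ltnS leq_eqVlt => /predU1P[->|/Dc].
- by exists n => //; rewrite ltnSn cn oner_eq0.
- by rewrite -[RHS](cW 0) //; apply: eq_bigr => j _; rewrite ltn_ord.
Qed.

End Wronskian.

(** * Gauss's lemma and relations over the constants *)
Lemma min_witness (P : nat -> Prop) :
  (exists n, P n) -> exists2 n, P n & forall m, P m -> (n <= m)%N.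
Proof.
have Pb n : reflect (P n) (boolp.asbool (P n)) by apply: boolp.asboolP.
case=> n0 Pn0; have ex : exists n, boolp.asbool (P n) by exists n0; apply/Pb.
by case: (ex_minnP ex) => n /Pb Pn nmin; exists n => // m /Pb; apply: nmin.
Qed.

Section Gauss.
Variable k : fieldType.
Implicit Types (a b : {poly k}) (p q G : {poly {poly k}}).

Lemma irreducible_factor b : (1 < size b)%N ->
  exists2 a, irreducible_poly a & a %| b.
Proof.
move=> b1; pose P n := exists a, [/\ (1 < size a)%N, a %| b & size a = n].
have [|n [a [a1 ab sa] amin]] := @min_witness P.
  by exists (size b), b; split.
exists a => //; split=> // c c1 ca.
have a0 : a != 0 by rewrite -size_poly_gt0 ltnW.
have c0 : c != 0 by apply: contraNneq a0 => c0; move: ca; rewrite c0 dvd0p.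
have := dvdp_leq a0 ca => sca.
rewrite -dvdp_size_eqp // eqn_leq sca /= sa; apply: amin.
exists c; split=> //; last exact: dvdp_trans ca ab.
by rewrite ltn_neqAle eq_sym c1 size_poly_gt0.
Qed.

(** Gauss's lemma: the product of the first coefficients of p and of q that a
    does not divide is, modulo a, a coefficient of p q. *)
Lemma dvd_coef_mul a p q : irreducible_poly a ->
  (forall j, a %| (p * q)`_j) -> (forall j, a %| p`_j) \/ (forall j, a %| q`_j).
Proof.
move=> irr apq.
have first_coef r : ~ (forall j, a %| r`_j) ->
    exists2 i, ~~ (a %| r`_i) & forall l, (l < i)%N -> a %| r`_l.
  move=> nr; have [|i ai imin] := @min_witness (fun i => ~~ (a %| r`_i)).
    apply: boolp.contrapT => H; apply: nr => j.
    by apply: contraT => aj; case: H; exists j.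
  by exists i => // l li; apply: contraLR li => /imin; rewrite -leqNgt.
case: (boolp.EM (forall j, a %| p`_j)) => [|/first_coef[i pi imin]]; first by left.
case: (boolp.EM (forall j, a %| q`_j)) => [|/first_coef[j qj jmin]]; first by right.
exfalso; have := apq (i + j)%N.
have ii : (i < (i + j).+1)%N by rewrite ltnS leq_addr.
rewrite coefM (bigD1 (Ordinal ii)) //= addKn dvdp_addl.
  have co : coprimep a p`_i.
    apply: contraNT pi => /(irr.2 _)/(_ (dvdp_gcdl _ _)) ga.
    by rewrite -(eqp_dvdl _ ga) dvdp_gcdr.
  by rewrite Gauss_dvdpr // (negPf qj).
apply: (big_ind (fun r => a %| r)); [exact: dvdp0|exact: dvdp_add|].
move=> l nl; have [li|il] := ltnP l i; first exact/dvdp_mulr/imin.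
apply/dvdp_mull/jmin; have {}il : (i < l)%N.
  by rewrite ltn_neqAle il andbT; apply: contra_neq nl => li; apply: val_inj.
by rewrite ltn_subLR ?ltn_add2r // -ltnS.
Qed.

(** When G is primitive, each irreducible factor of b divides q by
    [dvd_coef_mul] and can be cancelled. *)
Lemma gauss_cancel b p q G : b != 0 ->
  (forall a, irreducible_poly a -> ~ forall j, a %| G`_j) ->
  b *: p = q * G -> exists q', p = q' * G.
Proof.
move=> + primG; have [n] := ubnP (size b).
elim: n => // n IHn in b q *; rewrite ltnS => sb b0 bp.
have [b1|b1] := leqP (size b) 1.
  have [c c0 bc] : exists2 c, c != 0 & b = c%:P.
    by exists b`_0; [rewrite -polyC_eq0 -size1_polyC | apply: size1_polyC].
  exists ((c^-1)%:P *: q); rewrite -scalerAl -bp bc scalerA -polyCM.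
  by rewrite mulVf // scale1r.
have [a irr ab] := irreducible_factor b1.
have a0 := irredp_neq0 irr; move: (divpK ab) => bE.
have [aq|/primG//] : (forall j, a %| q`_j) \/ (forall j, a %| G`_j).
  by apply: dvd_coef_mul => // j; rewrite -bp coefZ dvdp_mulr.
pose q' := map_poly (fun c => c %/ a) q.
have qE : q = a *: q'.
  by apply/polyP=> j; rewrite coefZ coef_map_id0 ?div0p // mulrC divpK.
have b'0 : b %/ a != 0 by apply: contraNneq b0 => b'0; rewrite -bE b'0 mul0r.
apply: (IHn (b %/ a) q') => //.
  apply: leq_trans sb; rewrite size_divp // ltn_subrL.
  rewrite size_poly_gt0 b0 andbT; have := irr.1.
  by case: (size a) => [|[]].
have aP0 : a%:P != 0 by rewrite polyC_eq0.
apply: (mulfI aP0); rewrite !mul_polyC scalerA mulrC bE bp qE.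
by rewrite scalerAl.
Qed.

End Gauss.

(** Evaluation at a point (x, y) of polynomials over a field k of constants of
    D; the outer variable of {poly {poly k}} goes to y, the inner one to x. *)
Section Evaluation.
Variables (k F : fieldType) (iota : {rmorphism k -> F}) (D : F -> F) (x y : F).
Hypothesis der : derivation D.
Hypothesis Diota : forall c, D (iota c) = 0.
Implicit Types (a b : {poly k}) (p q G : {poly {poly k}}).

Definition ev1 : {rmorphism {poly k} -> F} := horner_eval x \o map_poly iota.
Definition ev2 : {rmorphism {poly {poly k}} -> F} :=
  horner_eval y \o map_poly ev1.

Lemma ev1X : ev1 'X = x. Proof. by rewrite /= map_polyX /horner_eval hornerX. Qed.
Lemma ev1C c : ev1 c%:P = iota c.
Proof. by rewrite /= map_polyC /horner_eval hornerC. Qed.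
Lemma ev2X : ev2 'X = y. Proof. by rewrite /= map_polyX /horner_eval hornerX. Qed.
Lemma ev2C a : ev2 a%:P = ev1 a.
Proof. by rewrite /= map_polyC /horner_eval hornerC. Qed.

Lemma D_ev1 a : D (ev1 a) = ev1 a^`() * D x.
Proof.
elim/poly_ind: a => [|a c IH].
  by rewrite deriv0 !rmorph0 mul0r (der0 der).
rewrite rmorphD rmorphM ev1X ev1C (derD der) (derM der) Diota addr0 IH.
rewrite derivD derivM derivX derivC addr0 mulr1 rmorphD rmorphM ev1X.
by rewrite mulrDl mulrAC.
Qed.

Lemma D_ev2 p : D (ev2 p) = ev2 (map_poly (@deriv k) p) * D x + ev2 p^`() * D y.
Proof.
elim/poly_ind: p => [|p a IH].
  by rewrite deriv0 !raddf0 !mul0r (der0 der) addr0.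
have -> : map_poly (@deriv k) (p * 'X + a%:P)
    = map_poly (@deriv k) p * 'X + a^`()%:P.
  apply/polyP=> j; rewrite coef_map_id0 ?deriv0 // !coefD !coefMX !coefC.
  rewrite coef_map_id0 ?deriv0 // derivD.
  by case: j => [|j] /=; rewrite ?deriv0 // coef_map_id0 ?deriv0.
rewrite !rmorphD !rmorphM ev2X !ev2C (derD der) (derM der) D_ev1 IH.
rewrite derivD derivM derivX derivC addr0 mulr1 rmorphD rmorphM ev2X.
by ring.
Qed.

Hypothesis char0 : forall n, (n%:R == 0 :> k) = (n == 0)%N.
Hypothesis Dx0 : D x != 0.

(** x is transcendental over the constants: if x is a root of a, then it is a
    root of a', because [D x] is not zero. *)
Lemma ev1_inj a : ev1 a = 0 -> a = 0.
Proof.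
have [n] := ubnP (size a); elim: n => // n IHn in a *; rewrite ltnS => sa ea.
have [->//|a0] := eqVneq a 0.
have /IHn da : (size a^`() < n)%N by apply: leq_trans sa; apply: lt_size_deriv.
have {}da : a^`() = 0.
  apply: da; apply/eqP; have /eqP := D_ev1 a; rewrite ea (der0 der) eq_sym.
  by rewrite mulf_eq0 (negPf Dx0) orbF.
have aE : a = (a`_0)%:P.
  apply/polyP=> [[|i]]; rewrite coefC //=; apply/eqP.
  have /polyP/(_ i)/eqP := da; rewrite coef_deriv coef0 -mulr_natr mulf_eq0.
  by rewrite char0 orbF.
move: ea; rewrite aE ev1C => /eqP; rewrite fmorph_eq0 => /eqP->.
by rewrite polyC0.
Qed.

(** The prime ideal of relations has height one.  Its generator G minimises the
    degree in y, so that pseudo-division by G leaves no remainder, then the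
    degree in x of the leading coefficient, which makes G primitive, so that
    the multiplier of the pseudo-division cancels. *)
Lemma ev2_principal p0 : p0 != 0 -> ev2 p0 = 0 ->
  exists2 G, ev2 G = 0 & forall p, ev2 p = 0 -> exists q, p = q * G.
Proof.
move=> p00 ep0.
have [|n [G0 [G00 eG0 sG0]] nmin] := @min_witness
  (fun n => exists G, [/\ G != 0, ev2 G = 0 & size G = n]).
  by exists (size p0), p0.
have [|m [G [nzG eG sG lG]] mmin] := @min_witness (fun m => exists G,
  [/\ G != 0, ev2 G = 0, size G = n & size (lead_coef G) = m]).
  by exists (size (lead_coef G0)), G0.
exists G => // p ep.
have lead0 : lead_coef G ^+ scalp p G != 0 by rewrite expf_neq0 ?lead_coef_eq0.
have modE := Pdiv.Idomain.divp_eq p G.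
have mod0 : p %% G = 0.
  apply/eqP/negPn/negP => r0; have := ltn_modp p G; rewrite nzG sG ltnNge.
  move/negP; apply; apply: nmin; exists (p %% G); split=> //.
  move/(congr1 ev2): modE; rewrite rmorphD rmorphM eG mulr0 add0r => <-.
  by rewrite -mul_polyC rmorphM ep mulr0.
rewrite mod0 addr0 in modE; apply: gauss_cancel lead0 _ modE => a irr aG.
have a0 := irredp_neq0 irr.
pose G' := map_poly (fun c => c %/ a) G.
have GE : G = a *: G'.
  by apply/polyP=> j; rewrite coefZ coef_map_id0 ?div0p // mulrC divpK.
have G'0 : G' != 0 by apply: contraNneq nzG => G'0; rewrite GE G'0 scaler0.
have lG' : lead_coef G = a * lead_coef G' by rewrite GE lead_coefZ.
have : (m <= size (lead_coef G'))%N.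
  apply: mmin; exists G'; split=> //; last by rewrite -sG GE size_scale.
  move/eqP: eG; rewrite GE -mul_polyC rmorphM mulf_eq0 ev2C => /orP[/eqP|/eqP//].
  by move/ev1_inj => aE; rewrite aE eqxx in a0.
rewrite -lG lG' size_mul ?lead_coef_eq0 // leqNgt => /negP; apply.
have := irr.1; have : (0 < size (lead_coef G'))%N.
  by rewrite size_poly_gt0 lead_coef_eq0.
by case: (size a) => [|[|s]] // _ _; rewrite !addSn /= ltnS leq_addl.
Qed.

End Evaluation.

(** * Total degree *)
Definition total_degree_le (R : nzRingType) n (p : {poly {poly R}}) :=
  forall i j, (n < i + j)%N -> p`_j`_i = 0.

Section TotalDegree.
Variable R : idomainType.
Implicit Types p q : {poly {poly R}}.

(** The substitution y := x y multiplies the coefficient of y^j by x^j, so that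
    the total degree becomes the degree in x, which is additive on products. *)
Let blowup p := p \Po ('X%:P * 'X).

Lemma coef_blowup p j : (blowup p)`_j = p`_j * 'X^j.
Proof.
rewrite /blowup comp_polyE.
under eq_bigr => i _.
  rewrite exprMn -polyC_exp -mul_polyC mulrA -polyCM mul_polyC; over.
rewrite -(poly_def (size p) (fun i => p`_i * 'X^i)) coef_poly.
by case: ltnP => // /(nth_default 0) ->; rewrite mul0r.
Qed.

Lemma total_degree_le_sizeY n p : (sizeY (blowup p) <= n.+1)%N -> total_degree_le n p.
Proof.
move=> sp i j ij; have := max_size_coefXY (blowup p) j.
rewrite coef_blowup => /leq_trans/(_ sp) sj.
have := coefMXn j p`_j (i + j)%N; rewrite ltnNge leq_addl addnK /= => <-.
by rewrite nth_default // (leq_trans sj).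
Qed.

Lemma sizeY_total_degree_le n p : total_degree_le n p -> (sizeY (blowup p) <= n.+1)%N.
Proof.
move=> tp; apply/bigmax_leqP=> j _; rewrite coef_blowup.
apply/leq_sizeP=> i ni; rewrite coefMXn; case: ltnP => // ji.
by apply: tp; rewrite subnK.
Qed.

Lemma blowup_eq0 p : (blowup p == 0) = (p == 0).
Proof.
apply/eqP/eqP=> [bp|->]; last by rewrite /blowup comp_poly0.
apply/polyP=> j; move/polyP/(_ j)/eqP: bp.
by rewrite coef_blowup !coef0 mulf_eq0 expf_eq0 polyX_eq0 andbF orbF => /eqP.
Qed.

Lemma total_degree_le_factor n p q : p * q != 0 -> total_degree_le n (p * q) -> total_degree_le n q.
Proof.
move=> pq0 /sizeY_total_degree_le spq; apply: total_degree_le_sizeY; apply: leq_trans spq.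
have [p0 q0] : p != 0 /\ q != 0 by apply/andP; rewrite -negb_or -mulf_eq0.
rewrite !sizeYE /blowup comp_polyM rmorphM size_mul ?swapXY_eq0 ?blowup_eq0 //.
have : (0 < size (swapXY (blowup p)))%N.
  by rewrite size_poly_gt0 swapXY_eq0 blowup_eq0.
by rewrite /blowup; case: (size (swapXY (p \Po _))) => // s _; rewrite leq_addl.
Qed.

End TotalDegree.

(** * Polynomials with vanishing Wronskian *)
Section PolynomialWronskian.
Variable R : idomainType.
Hypothesis char0 : forall n, (n%:R == 0 :> R) = (n == 0)%N.
Implicit Types f g : {poly R}.

Lemma coefM_top f g a b : (size f <= a.+1)%N -> (size g <= b.+1)%N ->
  (f * g)`_(a + b) = f`_a * g`_b.
Proof.
move=> fa gb; have ia : (a < (a + b).+1)%N by rewrite ltnS leq_addr.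
rewrite coefM (bigD1 (Ordinal ia)) //= addKn big1 ?addr0 // => i ni.
have [ai|ia'] := ltnP a i; first by rewrite (nth_default 0 (leq_trans fa ai)) mul0r.
have {}ai : (i < a)%N.
  by rewrite ltn_neqAle ia' andbT; apply: contra_neq ni => e; apply: val_inj.
by rewrite [g`_ _]nth_default ?mulr0 // (leq_trans gb) // ltn_subRL ltn_add2r.
Qed.

(** The top coefficients of f' g and f g' are deg f and deg g times the product
    of the leading coefficients. *)
Lemma wronskian_size f g : f != 0 -> g != 0 -> f^`() * g = f * g^`() ->
  size f = size g.
Proof.
move=> f0 g0 E.
(* Multiplying derivatives by 'X avoids predecessors of degrees. *)
have coefXd (h : {poly R}) i : ('X * h^`())`_i = h`_i *+ i.
  by rewrite coefXM; case: i => [|i]; rewrite ?mulr0n //= coef_deriv.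
have sizeXd (h : {poly R}) : (size ('X * h^`())%R <= (size h).-1.+1)%N.
  apply/leq_sizeP=> i hi; rewrite coefXd nth_default ?mul0rn //.
  exact: leq_trans (leqSpred _) hi.
have : ('X * f^`()) * g = f * ('X * g^`()) by rewrite -mulrA E mulrCA.
move/(congr1 (fun p : {poly R} => p`_((size f).-1 + (size g).-1))).
rewrite !coefM_top ?leqSpred ?sizeXd // !coefXd -!lead_coefE.
rewrite mulrnAl mulrnAr -mulr_natr -[RHS]mulr_natr.
have lfg : lead_coef f * lead_coef g != 0 by rewrite mulf_neq0 ?lead_coef_eq0.
move/(mulfI lfg) => eqs; have inj a b : a%:R = b%:R :> R -> (a <= b)%N.
  move=> ab; apply: contraT; rewrite -ltnNge => ba.
  have : (a - b == 0)%N by rewrite -char0 natrB ?(ltnW ba) // ab subrr.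
  by rewrite subn_eq0 leqNgt ba.
have : (size f).-1 = (size g).-1 by apply/eqP; rewrite eqn_leq !inj.
move: f0 g0; rewrite -!size_poly_gt0.
by case: (size f) => // s; case: (size g) => // t _ _ /= ->.
Qed.

(** The combination of f and g that cancels the leading terms still has
    vanishing Wronskian with g; if it were nonzero it would have the degree
    of g by [wronskian_size]. *)
Lemma wronskian_proportional f g : g != 0 -> f^`() * g = f * g^`() ->
  lead_coef g *: f = lead_coef f *: g.
Proof.
move=> g0 E; have [->|f0] := eqVneq f 0.
  by rewrite scaler0 lead_coef0 scale0r.
have sfg := wronskian_size f0 g0 E.
apply/eqP; rewrite -subr_eq0; set r := _ - _; apply/negPn/negP => r0.
have srg : size r = size g.
  apply: wronskian_size => //; rewrite /r derivB !derivZ !mulrBl.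
  by rewrite -!scalerAl E [_^`() * _]mulrC.
have : lead_coef r == 0.
  by rewrite lead_coefE srg coefB !coefZ !lead_coefE sfg mulrC subrr.
by rewrite lead_coef_eq0 (negPf r0).
Qed.

End PolynomialWronskian.

(** * Cofactors do not depend on the parameter *)
Section RootRemoval.
Variables (C : closedFieldType) (T : idomainType) (kappa : {rmorphism C -> T}).
Variable delta : T -> T.
Hypothesis deltaD : {morph delta : s t / s + t}.
Hypothesis deltaZ : forall c t, delta (kappa c * t) = kappa c * delta t.

Let delta0 : delta 0 = 0.
Proof. by have := deltaZ 0 0; rewrite rmorph0 !mul0r. Qed.

Lemma map_deltaM (p : {poly T}) z :
  map_poly delta (p * ('X - (kappa z)%:P)) =
  map_poly delta p * ('X - (kappa z)%:P).
Proof.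
apply/polyP=> i; rewrite coef_map_id0 // !mulrBr !coefB !coefMX !coefMC.
have dN t : delta (- t) = - delta t.
  by have := deltaZ (-1) t; rewrite rmorphN1 !mulN1r.
rewrite deltaD dN ![_ * kappa z]mulrC deltaZ coef_map_id0 //.
by case: i => [|i] /=; rewrite ?delta0 // coef_map_id0.
Qed.

(** Polynomials in the variable of {poly T} are families of elements of T with
    one parameter, on which [delta] acts coefficientwise.  At a root z of a the
    family L or the family G vanishes, as T is a domain; in either case the
    factor 'X - z is cancelled.  When a is constant, [map_poly delta G] has
    degree at most that of G, so L has degree 0 in the parameter.  The factors
    removed from G are collected in h. *)
Lemma const_cofactor (a : {poly C}) (G L : {poly T}) :
    a != 0 -> G != 0 -> map_poly kappa a * map_poly delta G = L * G ->
  exists (h : {poly C}) (G' : {poly T}) (l : T),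
    G = map_poly kappa h * G' /\ forall i, delta G'`_i = l * G'`_i.
Proof.
have [n] := ubnP (size a + size G)%N.
elim: n => // n IHn in a G L *; rewrite ltnS => sn a0 G0 E.
have [a1|a1] := leqP (size a) 1.
  have aE := size1_polyC a1; have c0 : a`_0 != 0 by rewrite -polyC_eq0 -aE.
  have [L0|L0] := eqVneq L 0.
    exists 1, G, 0; rewrite rmorph1 mul1r; split=> // i.
    move/polyP/(_ i): E; rewrite aE map_polyC coefCM L0 !mul0r coef0.
    rewrite coef_map_id0 // => /eqP; rewrite mulf_eq0 fmorph_eq0 (negPf c0).
    by move/eqP.
  have sL : (size L <= 1)%N.
    have : (size (L * G)%R <= size G)%N.
      rewrite -E aE map_polyC mul_polyC size_scale ?fmorph_eq0 //.
      by rewrite size_poly.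
    rewrite size_mul //; move: G0; rewrite -size_poly_gt0.
    case: (size G) => // s _; rewrite addnS /=.
    by rewrite -{2}[s]add0n -addnS -add1n addnCA leq_add2r.
  exists 1, G, (kappa (a`_0)^-1 * L`_0); rewrite rmorph1 mul1r; split=> // i.
  move/polyP/(_ i): E; rewrite aE (size1_polyC sL) map_polyC !coefCM.
  rewrite coef_map_id0 // -mulrA !coefC /= => <-.
  by rewrite mulrA -rmorphM mulVf // rmorph1 mul1r.
have /closed_rootP[z /factor_theorem[a' aE]] : size a != 1%N.
  by rewrite neq_ltn a1 orbT.
have a'0 : a' != 0 by apply: contraNneq a0 => a'0; rewrite aE a'0 mul0r.
have Xz0 : 'X - (kappa z)%:P != 0 by rewrite polyXsubC_eq0.
have aEk : map_poly kappa a = map_poly kappa a' * ('X - (kappa z)%:P).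
  by rewrite aE rmorphM rmorphB /= map_polyX map_polyC.
have : L.[kappa z] * G.[kappa z] = 0.
  by rewrite -hornerM -E aEk !hornerM hornerXsubC subrr mulr0 mul0r.
move/eqP; rewrite mulf_eq0 => /orP[/factor_theorem[L' LE]|/factor_theorem[G' GE]].
  apply: (IHn a' G L') => //.
    by apply: leq_trans sn; rewrite ltn_add2r aE size_mul ?polyXsubC_eq0 //
       size_XsubC addn2.
  by apply: (mulIf Xz0); rewrite mulrAC -aEk E LE mulrAC.
have G'0 : G' != 0 by apply: contraNneq G0 => G'0; rewrite GE G'0 mul0r.
have [||h [G2 [l [G'E dG2]]]] := IHn a G' L _ a0 G'0.
- by apply: leq_trans sn; rewrite ltn_add2l GE size_mul // size_XsubC addn2.
- by apply: (mulIf Xz0); rewrite -mulrA -map_deltaM -GE E GE mulrA.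
exists (h * ('X - z%:P)), G2, l; split=> //.
rewrite rmorphM rmorphB /= map_polyX map_polyC GE G'E; exact: mulrAC.
Qed.

End RootRemoval.

(** * Denominators and constants *)

(** The ring E of denominators stays the same when a variable is added to S and
    F, so that the statement can be iterated. *)
Lemma clear_denominators (E : idomainType) (S F : comNzRingType)
    (iota : {rmorphism E -> S}) (f : {rmorphism S -> F}) :
    (forall c, exists e, e != 0 /\ exists s, f (iota e) * c = f s) ->
  forall p : {poly F}, exists e, e != 0 /\
    exists P : {poly S}, (f (iota e))%:P * p = map_poly f P.
Proof.
move=> clear; elim/poly_ind=> [|p c [e [e0 [P eP]]]].
  by exists 1; split; [apply: oner_neq0|exists 0; rewrite mulr0 rmorph0].
have [d [d0 [s ds]]] := clear c.
exists (e * d); split; first by rewrite mulf_neq0.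
exists ((iota d)%:P * P * 'X + (iota e * s)%:P).
rewrite rmorphD !rmorphM /= map_polyX !map_polyC /= -eP.
by rewrite -ds !polyCM; ring.
Qed.

Lemma common_denominator (S : idomainType) (F : comNzRingType)
    (frac : {rmorphism S -> F}) :
    (forall c, exists e, e != 0 /\ exists s, frac e * c = frac s) ->
  forall p : {poly {poly F}}, exists e : S, e != 0 /\
    exists P : {poly {poly S}}, (frac e)%:P%:P * p = map_poly (map_poly frac) P.
Proof.
move=> clear0 p.
have clear1 (q : {poly F}) : exists e : S, e != 0 /\
    exists s, map_poly frac ((polyC \o idfun) e) * q = map_poly frac s.
  have [e [e0 [P eP]]] := clear_denominators (iota := idfun) clear0 q.
  by exists e; split=> //; exists P; rewrite -eP /= map_polyC.
have [e [e0 [P eP]]] := clear_denominators clear1 p.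
by exists e; split=> //; exists P; rewrite -eP /= map_polyC.
Qed.

Section Constants.
Variables (F : fieldType) (D : F -> F).
Definition constant_pred (der : derivation D) : {pred F} := fun f => D f == 0.

Hypothesis der : derivation D.
Local Notation K := (constant_pred der).

Fact constant_divring_closed : divring_closed K.
Proof.
have [/= DD DM] := der.
split=> [|f g|f g]; rewrite /in_mem /= /constant_pred.
- by rewrite (der1 der).
- by move=> /eqP f0 /eqP g0; rewrite (derB der) f0 g0 subrr.
move=> /eqP f0 /eqP g0; have [->|gn0] := eqVneq g 0.
  by rewrite invr0 mulr0 (der0 der).
have /esym/eqP := DM (f / g) g; rewrite divfK // f0 g0 mulr0 addr0.
by rewrite mulf_eq0 (negPf gn0) orbF.
Qed.

HB.instance Definition _ := GRing.isDivringClosed.Build F K constant_divring_closed.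

Definition constants := {f : F | K f}.
HB.instance Definition _ := [isSub of constants for @sval F K].
HB.instance Definition _ := [Choice of constants by <:].
HB.instance Definition _ := [SubChoice_isSubIntegralDomain of constants by <:].
HB.instance Definition _ := [SubIntegralDomain_isSubField of constants by <:].

End Constants.

(** * Polynomial vector fields on the plane *)

(** The vector field A d/dx + B d/dy, for the inner variable x and the outer
    variable y. *)
Definition plane_vf (R : comNzRingType) (A B p : {poly {poly R}}) :=
  A * map_poly (@deriv R) p + B * p^`().

Section PlaneVectorField.
Variables (R : comNzRingType) (A B : {poly {poly R}}).

Lemma derivXM (p q : {poly {poly R}}) : map_poly (@deriv R) (p * q)
  = map_poly (@deriv R) p * q + p * map_poly (@deriv R) q.
Proof.
apply/polyP=> j; rewrite coefD !coefM coef_map_id0 ?deriv0 // coefM.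
rewrite raddf_sum -big_split; apply: eq_bigr => i _ /=.
by rewrite derivM !coef_map_id0 ?deriv0.
Qed.

Lemma plane_vf_derivation : derivation (plane_vf A B).
Proof.
split=> p q; rewrite /plane_vf.
  by rewrite raddfD derivD !mulrDr; rewrite addrACA.
rewrite derivXM derivM; ring.
Qed.

Lemma plane_vfZ (c : R) p :
  plane_vf A B (c%:P%:P * p) = c%:P%:P * plane_vf A B p.
Proof.
rewrite (derM plane_vf_derivation) {1}/plane_vf derivC mulr0 addr0.
by rewrite map_polyC /= derivC polyC0 mulr0 mul0r add0r.
Qed.

Lemma plane_vfX : plane_vf A B 'X%:P = A.
Proof. by rewrite /plane_vf map_polyC /= derivX polyC1 derivC mulr1 mulr0 addr0. Qed.

Lemma plane_vfY : plane_vf A B 'X = B.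
Proof.
rewrite /plane_vf derivX mulr1.
have -> : map_poly (@deriv R) 'X = 0.
  apply/polyP=> i; rewrite coef_map_id0 ?deriv0 // coefX coef0.
  by case: eqP => _; rewrite ?deriv0 // -polyC1 derivC.
by rewrite mulr0 add0r.
Qed.

End PlaneVectorField.

Lemma map_plane_vf (R S : comNzRingType) (f : {rmorphism R -> S}) A B p :
  map_poly (map_poly f) (plane_vf A B p) =
  plane_vf (map_poly (map_poly f) A) (map_poly (map_poly f) B)
    (map_poly (map_poly f) p).
Proof.
rewrite /plane_vf rmorphD !rmorphM /= -deriv_map; congr (_ * _ + _).
apply/polyP=> j; rewrite coef_map coef_map_id0 ?deriv0 // coef_map_id0 ?deriv0 //.
by rewrite coef_map deriv_map.
Qed.

Section Specialisation.
Variable C : closedFieldType.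
Local Notation S := {poly {poly C}}.

(** Restriction to the vertical line x = x0; the remaining variable of
    {poly C} is the parameter of the line. *)
Definition at_line (x0 : C) : {rmorphism S -> {poly C}} :=
  map_poly (horner_eval x0).

Lemma at_line_neq0 (p : S) : p != 0 -> exists x0, at_line x0 p != 0.
Proof.
rewrite -lead_coef_eq0 => /closed_nonrootP[x0 x0p]; exists x0.
apply: contraNneq x0p => /polyP/(_ (size p).-1).
by rewrite coef_map coef0 /= /horner_eval -lead_coefE => /rootP.
Qed.

(** Restriction of the coefficients of a polynomial in (X, Y) to the line
    x = x0, followed by the exchange of variables that makes the parameter of
    the line outermost: the result is a family of polynomials in (X, Y) with
    one parameter. *)
Definition on_line (x0 : C) : {rmorphism {poly {poly S}} -> {poly S}} :=
  @swapXY _ \o map_poly (@swapXY _ \o map_poly (at_line x0)).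

Lemma coef_on_line x0 (p : {poly {poly S}}) a j i :
  (on_line x0 p)`_a`_j`_i = (at_line x0 p`_j`_i)`_a.
Proof. by rewrite /= coef_swapXY coef_map /= coef_swapXY coef_map. Qed.

Lemma on_lineC x0 (e : S) :
  on_line x0 e%:P%:P = map_poly (polyC \o polyC) (at_line x0 e).
Proof.
apply/polyP=> a; apply/polyP=> j; apply/polyP=> i; rewrite coef_on_line.
rewrite [in RHS]coef_map /= !coefC; case: j => [|j] /=; rewrite coefC.
  by rewrite coefC; case: i => [|i] //=; rewrite raddf0 coef0.
by rewrite if_same raddf0 !coef0.
Qed.

Lemma on_line_const x0 (A : S) :
  on_line x0 (map_poly (map_poly (polyC \o polyC)) A) = A%:P.
Proof.
apply/polyP=> a; apply/polyP=> j; apply/polyP=> i; rewrite coef_on_line.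
have lineC c : at_line x0 c%:P%:P = c%:P.
  by rewrite /= map_polyC /= /horner_eval hornerC.
have -> : (map_poly (map_poly (polyC \o polyC)) A)`_j`_i = (A`_j`_i)%:P%:P.
  by rewrite !coef_map.
rewrite lineC !coefC.
by case: eqP; rewrite ?coef0.
Qed.

Lemma on_line_plane_vf x0 (A B : S) (p : {poly {poly S}}) :
  on_line x0 (plane_vf (map_poly (map_poly (polyC \o polyC)) A)
                       (map_poly (map_poly (polyC \o polyC)) B) p)
  = map_poly (plane_vf A B) (on_line x0 p).
Proof.
rewrite /plane_vf rmorphD !rmorphM !on_line_const; apply/polyP=> a.
rewrite coefD !coefCM coef_map_id0; last by rewrite !raddf0 !mulr0 addr0.
congr (_ * _ + _ * _); apply/polyP=> j; apply/polyP=> i; rewrite coef_on_line.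
  have dcoef (R : comNzRingType) (q : {poly {poly R}}) :
    (map_poly (@deriv R) q)`_j = (q`_j)^`() by rewrite coef_map_id0 ?deriv0.
  by rewrite !dcoef !coef_deriv raddfMn coefMn coef_on_line.
by rewrite !coef_deriv !coefMn raddfMn coefMn coef_on_line.
Qed.

End Specialisation.

(** The y-Wronskian reduces the claim to the leading coefficients in y, which
    are polynomials in x, and the x-Wronskian then applies to these. *)
Lemma proportional_planar (C : numClosedFieldType) (f g : {poly {poly C}}) :
  g != 0 -> f^`() * g = f * g^`() ->
  map_poly (@deriv C) f * g = f * map_poly (@deriv C) g ->
  f = (lead_coef (lead_coef f) / lead_coef (lead_coef g))%:P%:P * g.
Proof.
move=> g0 Ey Ex.
have char0_C n : (n%:R == 0 :> C) = (n == 0)%N by exact: pnatr_eq0.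
have char0_P n : (n%:R == 0 :> {poly C}) = (n == 0)%N.
  by rewrite -polyC_natr polyC_eq0 char0_C.
have := wronskian_proportional char0_P g0 Ey.
set lf := lead_coef f; set lg := lead_coef g => E.
have lg0 : lg != 0 by rewrite lead_coef_eq0.
have {}E : lg%:P * f = lf%:P * g by rewrite !mul_polyC.
have : lf^`() * lg = lf * lg^`().
  have := congr1 (map_poly (@deriv C)) E.
  rewrite !derivXM !map_polyC /=.
  move: (map_poly _ f) (map_poly _ g) Ex => fx gx Ex E'.
  have : lg^`()%:P * f * g = lf^`()%:P * g * g.
    apply/eqP; rewrite -subr_eq0; apply/eqP.
    transitivity ((lg^`()%:P * f + lg%:P * fx - (lf^`()%:P * g + lf%:P * gx)) * g
      - lg%:P * (fx * g) + lf%:P * g * gx); first by ring.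
    by rewrite E' subrr mul0r Ex -E; ring.
  move/(mulIf g0)/(congr1 ( *%R lg%:P)).
  rewrite mulrCA E !mulrA => /(mulIf g0).
  by rewrite -!polyCM => /polyC_inj; rewrite mulrC [lg * _]mulrC => ->.
move/(wronskian_proportional char0_C lg0) => E2.
have lgP : lg%:P != 0 by rewrite polyC_eq0.
apply: (mulfI lgP); rewrite E mulrA -polyCM; congr (_%:P * _).
have llg0 : lead_coef lg != 0 by rewrite lead_coef_eq0.
by rewrite mulrC mul_polyC mulrC -scalerA -E2 scalerA mulVf // scale1r.
Qed.

(** * From a relation over the constants to a pencil *)

(** F is the field of rational functions on the plane and k the field of its
    constants.  Both are kept abstract and used only through the properties
    listed here. *)
Section Affine.
Variable C : numClosedFieldType.
Local Notation S := {poly {poly C}}.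
Variables (k F : fieldType) (frac : {rmorphism S -> F}).
Variables (iota : {rmorphism k -> F}) (kappa : {rmorphism C -> k}).
Hypothesis frac_inj : injective frac.
Hypothesis fracP : forall c, exists e : S, e != 0 /\ exists s, frac e * c = frac s.
Hypothesis iota_kappa : forall c, iota (kappa c) = frac c%:P%:P.
Variables (A B : S) (D : F -> F).
Hypothesis der : derivation D.
Hypothesis D_frac : forall s, D (frac s) = frac (plane_vf A B s).
Hypothesis Diota : forall c, D (iota c) = 0.
Hypothesis iota_onto : forall f, D f = 0 -> exists c, iota c = f.

Local Notation vf := (plane_vf A B).
Local Notation toK := (map_poly (map_poly kappa)).
Local Notation evK := (ev2 iota (frac 'X%:P) (frac 'X)).

Lemma evK_toK s : evK (toK s) = frac s.
Proof.
elim/poly_ind: s => [|s a IH]; first by rewrite !raddf0.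
have -> : toK (s * 'X + a%:P) = toK s * 'X + (map_poly kappa a)%:P.
  by rewrite rmorphD rmorphM /= map_polyX map_polyC.
rewrite !rmorphD !rmorphM IH ev2X ev2C; congr (_ + _).
elim/poly_ind: a => [|a c IHa]; first by rewrite !raddf0.
rewrite polyCD polyCM !rmorphD !rmorphM.
congr (_ * _ + _); first exact: IHa.
  exact: etrans (congr1 (ev1 iota _) (map_polyX kappa)) (ev1X _ _).
rewrite -iota_kappa -(ev1C iota (frac 'X%:P)); congr (ev1 _ _ _).
exact: map_polyC.
Qed.

Lemma evK_vf p : evK (plane_vf (toK A) (toK B) p) = D (evK p).
Proof.
rewrite (D_ev2 _ _ der Diota) /plane_vf rmorphD !rmorphM !evK_toK !D_frac.
by rewrite plane_vfX plane_vfY mulrC [X in _ + X]mulrC.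
Qed.

(** The rank of the matrix of coefficients of the [u j] does not change when
    the base field is extended from C to k. *)
Lemma free_over_constants N (u : nat -> S) n (c : nat -> k) :
  (forall j, (j < N)%N -> total_degree_le n (u j)) ->
  (forall b : nat -> C, \sum_(j < N) (b j)%:P%:P * u j = 0 ->
     forall j, (j < N)%N -> b j = 0) ->
  \sum_(j < N) (c j)%:P%:P * toK (u j) = 0 -> forall j, (j < N)%N -> c j = 0.
Proof.
move=> tu fu cu j jN.
pose M := \matrix_(l < N, m < n.+1 * n.+1) (u l)`_(m %/ n.+1)`_(m %% n.+1).
have coef_comb b i h : (\sum_(l < N) (b l)%:P%:P * u l)`_h`_i
    = \sum_(l < N) b l * (u l)`_h`_i.
  by rewrite !coef_sum; apply: eq_bigr => l _; rewrite !coefCM.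
(* The entry in column m of M is the coefficient of x^i y^h for
   m = h (n + 1) + i. *)
have Mfree : row_free M.
  apply: inj_row_free => v vM; pose b l := oapp (v 0) 0 (insub l).
  have bE (l : 'I_N) : b l = v 0 l by rewrite /b valK.
  apply/rowP=> l; rewrite mxE -bE; apply: fu (ltn_ord l).
  apply/polyP=> h; apply/polyP=> i; rewrite coef_comb !coef0.
  have [ni|ni] := ltnP n (i + h).
    by rewrite big1 // => r _; rewrite (tu r) ?mulr0.
  have lt_i : (i < n.+1)%N by rewrite ltnS (leq_trans _ ni) ?leq_addr.
  have lt_h : (h < n.+1)%N by rewrite ltnS (leq_trans _ ni) ?leq_addl.
  have lt_m : (h * n.+1 + i < n.+1 * n.+1)%N.
    by rewrite (@leq_trans (h.+1 * n.+1)) ?leq_mul2r // mulSn addnC ltn_add2r.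
  have /rowP/(_ (Ordinal lt_m)) := vM; rewrite !mxE => vMm.
  rewrite -[RHS]vMm.
  apply: eq_bigr => r _; rewrite !mxE bE /=.
  by rewrite divnMDl // divn_small // addn0 modnMDl modn_small.
have cM : (\row_(l < N) c l) *m map_mx kappa M = 0.
  apply/rowP=> m; rewrite !mxE.
  have := congr1 (fun p : {poly {poly k}} => p`_(m %/ n.+1)`_(m %% n.+1)) cu.
  rewrite /= !coef0 !coef_sum => cum; rewrite -[RHS]cum; apply: eq_bigr => l _.
  by rewrite !mxE !coefCM !coef_map.
have : row_free (map_mx kappa M) by rewrite row_free_map.
move/row_free_inj/(_ (\row_l c l) 0); rewrite cM mul0mx => /(_ erefl).
by move/rowP/(_ (Ordinal jN)); rewrite !mxE.
Qed.

Lemma constant_relation N (u : nat -> S) n :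
  (forall j, (j < N)%N -> total_degree_le n (u j)) ->
  (forall b : nat -> C, \sum_(j < N) (b j)%:P%:P * u j = 0 ->
     forall j, (j < N)%N -> b j = 0) ->
  \det (\matrix_(i < N, j < N) iter i vf (u j)) = 0 ->
  exists p, [/\ p != 0, total_degree_le n p & evK p = 0].
Proof.
move=> tu fu detu.
have iterE i s : frac (iter i vf s) = iter i D (frac s).
  by elim: i => //= i IH; rewrite -D_frac IH.
have : \det (\matrix_(i < N, j < N) iter i D (frac (u j))) = 0.
  rewrite -[RHS](rmorph0 frac) -detu -det_map_mx; congr (\det _).
  by apply/matrixP=> i j; rewrite !mxE iterE.
case/(@wronskian_dependence _ _ der _ (fun j => frac (u j))) => f [Df [j jN fj] fu0].
pose c j := sval (boolp.cid (iota_onto (Df j))).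
have cE i : iota (c i) = f i by rewrite /c; case: boolp.cid.
exists (\sum_(i < N) (c i)%:P%:P * toK (u i)); split.
- apply: contraNneq fj => c0; rewrite -cE (free_over_constants tu fu c0) //.
  by rewrite rmorph0.
- move=> i h ih; rewrite !coef_sum big1 // => l _; rewrite !coefCM.
  by rewrite !coef_map /= (tu l) ?rmorph0 ?mulr0.
- rewrite rmorph_sum -[RHS]fu0; apply: eq_bigr => i _.
  by rewrite rmorphM evK_toK ev2C ev1C cE.
Qed.

Let char0_C n : (n%:R == 0 :> C) = (n == 0)%N. Proof. exact: pnatr_eq0. Qed.

Let char0_k n : (n%:R == 0 :> k) = (n == 0)%N.
Proof. by rewrite -(rmorph_nat kappa) fmorph_eq0. Qed.

Hypothesis A0 : A != 0.

Let frac_eq0 s : (frac s == 0) = (s == 0).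
Proof. by rewrite -(inj_eq frac_inj) rmorph0. Qed.

(** The coefficients of G are constants, so the derivative of the value of G at
    (x, y) is the value of [plane_vf _ _ G]: this polynomial is again a
    relation, hence a multiple of the generator G. *)
Lemma invariant_relation n p : p != 0 -> total_degree_le n p -> evK p = 0 ->
  exists G L, [/\ G != 0, total_degree_le n G, evK G = 0
    & plane_vf (toK A) (toK B) G = L * G].
Proof.
move=> p0 tp ep.
have Dx0 : D (frac 'X%:P) != 0 by rewrite D_frac plane_vfX frac_eq0.
have [G eG Gdvd] := ev2_principal der Diota char0_k Dx0 p0 ep.
have [q pE] := Gdvd p ep.
have [L LE] : exists L, plane_vf (toK A) (toK B) G = L * G.
  by apply: Gdvd; rewrite evK_vf eG (der0 der).
exists G, L; split=> //; last by apply: (@total_degree_le_factor _ _ q); rewrite -pE.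
by apply: contraNneq p0 => G0; rewrite pE G0 mulr0.
Qed.

Local Notation toS := (map_poly (map_poly (polyC \o polyC))).

Lemma clear_invariant_relation G L :
  plane_vf (toK A) (toK B) G = L * G ->
  exists (e1 e2 : S) (G' L' : {poly {poly S}}),
    [/\ e1 != 0, e2 != 0, forall j i, frac G'`_j`_i = frac e1 * iota G`_j`_i
      & e2%:P%:P * plane_vf (toS A) (toS B) G' = L' * G'].
Proof.
move=> LG.
have [e1 [e10 [G' GE]]] := common_denominator fracP (map_poly (map_poly iota) G).
have [e2 [e20 [L' LE]]] := common_denominator fracP (map_poly (map_poly iota) L).
exists e1, e2, G', L'; split=> // [j i|].
  have := congr1 (fun p : {poly {poly F}} => p`_j`_i) GE.
  by rewrite /= !coefCM !coef_map /= => ->.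
have psi_inj : injective (map_poly (map_poly frac)).
  by apply: map_inj_poly => [p q|]; [apply: map_inj_poly|]; rewrite ?rmorph0.
have toE p : map_poly (map_poly frac) (toS p) = map_poly (map_poly iota) (toK p).
  by apply/polyP=> j; apply/polyP=> i; rewrite !coef_map /= iota_kappa.
have mapM (R1 R2 : comNzRingType) (f : {rmorphism R1 -> R2}) p q :
    map_poly (map_poly f) (p * q) = map_poly (map_poly f) p * map_poly (map_poly f) q.
  exact: rmorphM.
apply: psi_inj; rewrite !mapM map_plane_vf !toE -LE -GE plane_vfZ.
rewrite -map_plane_vf LG mapM !map_polyC /= !map_polyC /=.
by rewrite [RHS]mulrACA !mulrA.
Qed.

(** Otherwise all the Wronskians in y of pairs of coefficients vanish.  The
    ratios of the coefficients being annihilated by A d/dx + B d/dy with A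
    nonzero, those in x vanish too, so G is proportional to a polynomial over
    C; but a nonzero polynomial over C does not vanish at (x, y). *)
Lemma independent_coefficients G e1 (G' : {poly {poly S}}) :
    G != 0 -> evK G = 0 -> e1 != 0 ->
    (forall j i, frac G'`_j`_i = frac e1 * iota G`_j`_i) ->
  exists j i j' i', (G'`_j`_i)^`() * G'`_j'`_i' != G'`_j`_i * (G'`_j'`_i')^`().
Proof.
move=> G0 eG e10 GE.
have [j0 [i0 g00]] : exists j i, G`_j`_i != 0.
  apply: boolp.contrapT => nG; case/eqP: G0; apply/polyP=> j; apply/polyP=> i.
  rewrite !coef0; apply: boolp.contrapT => /eqP Gji.
  by apply: nG; exists j, i.
apply: boolp.contrapT => nW.
have {nW} W j i : (G'`_j`_i)^`() * G'`_j0`_i0 = G'`_j`_i * (G'`_j0`_i0)^`().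
  by apply: boolp.contrapT => /eqP Wji; apply: nW; exists j, i, j0, i0.
set g0 := G'`_j0`_i0 in W.
have g0n : g0 != 0 by rewrite -frac_eq0 GE mulf_neq0 ?frac_eq0 ?fmorph_eq0.
(* The complex constant g / g0, when g is proportional to g0. *)
pose ratio (g : S) := lead_coef (lead_coef g) / lead_coef (lead_coef g0).
have ratio0 : ratio 0 = 0 by rewrite /ratio !lead_coef0 mul0r.
have ratioP j i : G'`_j`_i = (ratio G'`_j`_i)%:P%:P * g0.
  apply: proportional_planar => //; move: (W j i).
  have : vf G'`_j`_i * g0 = G'`_j`_i * vf g0.
    apply: frac_inj; rewrite !rmorphM -!D_frac !GE !(derM der) !Diota.
    by rewrite !mulr0 !addr0; ring.
  move: (G'`_j`_i) => g; rewrite /plane_vf => vfE Wg.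
  apply: (mulfI A0); apply/eqP; rewrite -subr_eq0; apply/eqP.
  transitivity ((A * map_poly deriv g + B * g^`()) * g0
    - g * (A * map_poly deriv g0 + B * g0^`()) - B * (g^`() * g0 - g * g0^`())).
    by ring.
  by rewrite vfE Wg !subrr mulr0 subr0.
pose H := map_poly (map_poly ratio) G'.
have HE j i : H`_j`_i = ratio G'`_j`_i.
  rewrite coef_map_id0; first by rewrite coef_map_id0.
  by apply/polyP=> l; rewrite coef_map_id0 ?coef0.
have GH : G = (G`_j0`_i0)%:P%:P * toK H.
  apply/polyP=> j; apply/polyP=> i; rewrite !coefCM !coef_map /= HE.
  apply: (fmorph_inj iota); have e1n : frac e1 != 0 by rewrite frac_eq0.
  apply: (mulfI e1n); rewrite -GE [in LHS]ratioP (rmorphM frac).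
  rewrite -iota_kappa GE (rmorphM iota) mulrCA; congr (_ * _); exact: mulrC.
have H0 : H = 0.
  apply/eqP; rewrite -frac_eq0 -evK_toK; move/eqP: eG.
  by rewrite GH rmorphM ev2C ev1C mulf_eq0 fmorph_eq0 (negPf g00).
by move: g00; rewrite GH H0 !rmorph0 mulr0 !coef0 eqxx.
Qed.

End Affine.

Section Pencil.
Variable C : closedFieldType.
Local Notation S := {poly {poly C}}.
Local Notation toS := (map_poly (map_poly (polyC \o polyC))).

(** On a line x = x0 where neither the denominator e nor the Wronskian of the
    two coefficients vanishes, [const_cofactor] applies.  The common factor h
    does not affect proportionality, so two members of the family are not
    proportional. *)
Lemma cofactor_pencil (A B : S) n (e : S) (G L : {poly {poly S}}) :
    e != 0 -> total_degree_le n G ->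
    e%:P%:P * plane_vf (toS A) (toS B) G = L * G ->
    (exists j i j' i',
       (G`_j`_i)^`() * G`_j'`_i' != G`_j`_i * (G`_j'`_i')^`()) ->
  exists G1 G2 : S, [/\ total_degree_le n G1, total_degree_le n G2, G2 != 0,
    forall c, G1 != c%:P%:P * G2
    & plane_vf A B G1 * G2 = G1 * plane_vf A B G2].
Proof.
move=> e0 tG eG [j [i [j' [i' W0]]]].
have vf_der := plane_vf_derivation A B.
set g := G`_j`_i in W0; set g' := G`_j'`_i' in W0.
have [x0 x0E] : exists x0, at_line x0 (e * (g^`() * g' - g * g'^`())) != 0.
  by apply: at_line_neq0; rewrite mulf_neq0 // subr_eq0.
rewrite rmorphM mulf_eq0 negb_or rmorphB in x0E; case/andP: x0E => xe.
rewrite !rmorphM /= -!deriv_map -!/(at_line x0 _) => xW.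
have GxE a l m : (on_line x0 G)`_a`_l`_m = (at_line x0 G`_l`_m)`_a.
  exact: coef_on_line.
have Gx0 : on_line x0 G != 0.
  apply: contraNneq xW => Gx0.
  have at0 l m : at_line x0 G`_l`_m = 0.
    by apply/polyP=> a; rewrite -GxE Gx0 !coef0.
  by rewrite !at0 deriv0 !mul0r subrr.
have := congr1 (on_line x0) eG.
rewrite !rmorphM on_lineC on_line_plane_vf => eGx.
have [h [G2 [l [GE dG]]]] := @const_cofactor C S
  (polyC \o polyC) _ (derD vf_der) (fun c t => plane_vfZ A B c t)
  _ _ _ xe Gx0 eGx.
(* The coefficient of X^m Y^l, as a polynomial in the parameter. *)
pose slice l m (t : {poly S}) := \poly_(a < size t) t`_a`_l`_m.
have coef_slice l' m t a : (slice l' m t)`_a = t`_a`_l'`_m.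
  by rewrite coef_poly; case: ltnP => // /(nth_default 0)->; rewrite !coef0.
have atE l' m : at_line x0 G`_l'`_m = h * slice l' m G2.
  apply/polyP=> a; rewrite -GxE GE !coefM !coef_sum; apply: eq_bigr => b _.
  by rewrite coef_map /= !coefCM coef_slice.
have {xW} : h ^+ 2 * ((slice j i G2)^`() * slice j' i' G2
    - slice j i G2 * (slice j' i' G2)^`()) != 0.
  by apply: contraNneq xW => s0; rewrite !atE !derivM -[X in _ == X]s0; apply/eqP; ring.
rewrite mulf_eq0 negb_or expf_eq0 /= => /andP[h0].
set s := slice j i G2; set s' := slice j' i' G2 => sW.
have tG2 a : total_degree_le n G2`_a.
  move=> m l' ml; rewrite -coef_slice.
  suff -> : slice l' m G2 = 0 by rewrite coef0.
  by apply: (mulfI h0); rewrite -atE tG // rmorph0 mulr0.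
have [a [b ab]] : exists a b, s`_a * s'`_b != s`_b * s'`_a.
  apply: boolp.contrapT => nab; case/negP: sW.
  have {}nab a b : s`_a * s'`_b = s`_b * s'`_a.
    by apply: boolp.contrapT => /eqP nE; apply: nab; exists a, b.
  have [->|s'0] := eqVneq s' 0; first by rewrite deriv0 !mulr0 subrr.
  have sE : s = (s`_(size s').-1 / lead_coef s') *: s'.
    apply/polyP=> a; rewrite coefZ mulrAC -nab lead_coefE mulfK //.
    by rewrite -lead_coefE lead_coef_eq0.
  by rewrite sE derivZ -!scalerAl [s'^`() * s']mulrC subrr.
exists G2`_a, G2`_b; rewrite !coef_slice in ab; split=> //.
- by apply: contraNneq ab => ->; rewrite !coef0 mul0r mulr0.
- by move=> c; apply: contraNneq ab => ->; rewrite !coefCM; apply/eqP; ring.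
- by rewrite !dG; ring.
Qed.

End Pencil.

(** When A is zero, the coordinate x is annihilated by the field; it has degree
    1, and a relation of degree 0 is impossible. *)
Lemma planar_pencil_over (C : numClosedFieldType) (k F : fieldType)
    (frac : {rmorphism {poly {poly C}} -> F}) (iota : {rmorphism k -> F})
    (kappa : {rmorphism C -> k}) (A B : {poly {poly C}}) (D : F -> F) :
    injective frac ->
    (forall c, exists e, e != 0 /\ exists s, frac e * c = frac s) ->
    (forall c, iota (kappa c) = frac c%:P%:P) ->
    derivation D -> (forall s, D (frac s) = frac (plane_vf A B s)) ->
    (forall c, D (iota c) = 0) -> (forall f, D f = 0 -> exists c, iota c = f) ->
  forall N (u : nat -> {poly {poly C}}) n,
    (forall j, (j < N)%N -> total_degree_le n (u j)) ->
    (forall b : nat -> C, \sum_(j < N) (b j)%:P%:P * u j = 0 ->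
       forall j, (j < N)%N -> b j = 0) ->
    \det (\matrix_(i < N, j < N) iter i (plane_vf A B) (u j)) = 0 ->
  exists G1 G2, [/\ total_degree_le n G1, total_degree_le n G2, G2 != 0,
    forall c, G1 != c%:P%:P * G2
    & plane_vf A B G1 * G2 = G1 * plane_vf A B G2].
Proof.
move=> frac_inj fracP iotak der Df Diota iota_onto N u n tu fu detu.
have [p [p0 tp ep]] :=
  constant_relation iotak der Df iota_onto tu fu detu.
have [A0|A0] := eqVneq A 0; last first.
  have [G [L [G0 tG eG LG]]] :=
    invariant_relation frac_inj iotak der Df Diota A0 p0 tp ep.
  have [e1 [e2 [G' [L' [e10 e20 GE eG']]]]] :=
    clear_invariant_relation frac_inj fracP iotak LG.
  apply: (cofactor_pencil e20 _ eG').
    move=> i j ij; apply: frac_inj; rewrite GE tG //.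
    by rewrite !rmorph0 mulr0.
  exact: (independent_coefficients frac_inj iotak der Df Diota A0 G0 eG e10 GE).
case: n => [|n] in tu tp *.
  have pE : p = (p`_0`_0)%:P%:P.
    apply/polyP=> j; apply/polyP=> i; rewrite !coefC.
    case: j => [|j] /=; last by rewrite coef0 tp ?addnS.
    by rewrite coefC; case: i => [|i] //=; apply: tp.
  move: (p`_0`_0) pE p0 ep => c -> {}p0; rewrite ev2C ev1C => /eqP.
  by rewrite fmorph_eq0 => /eqP c0; rewrite c0 eqxx in p0.
exists 'X%:P, 1; split.
- move=> i j ij; rewrite coefC; case: j ij => [|j] ij; rewrite /= ?coef0 // coefX.
  by rewrite addn0 in ij; case: i ij => [|[]].
- move=> i j; rewrite -polyC1 coefC; case: j => [|j] ij; rewrite /= ?coef0 //.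
  by rewrite -polyC1 coefC; case: i ij.
- exact: oner_neq0.
- move=> c; rewrite mulr1; apply/eqP=> /polyC_inj/(congr1 (fun q : {poly C} => q`_1)).
  by rewrite coefX coefC => /eqP; rewrite oner_eq0.
- by rewrite plane_vfX A0 mul0r (der1 (plane_vf_derivation _ _)) mulr0.
Qed.

Section Instantiation.
Variables (C : numClosedFieldType) (A B : {poly {poly C}}).
Local Notation S := {poly {poly C}}.
Local Notation frac := (@FracField.tofrac S).

Let der := fracder_derivation (plane_vf_derivation A B).

Fact scalar_constant_subproof (c : C) : constant_pred der (frac c%:P%:P).
Proof.
rewrite /constant_pred fracder_tofrac; last exact: plane_vf_derivation.
have := plane_vfZ A B c 1; rewrite mulr1 => ->.
by rewrite (der1 (plane_vf_derivation A B)) mulr0 rmorph0.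
Qed.

Definition scalar_constant (c : C) : constants der := Sub (frac c%:P%:P) (scalar_constant_subproof c).

Fact scalar_constant_is_zmod_morphism : zmod_morphism scalar_constant.
Proof. by move=> a b; apply: val_inj; rewrite /= !rmorphB. Qed.

Fact scalar_constant_is_monoid_morphism : monoid_morphism scalar_constant.
Proof. by split=> [|a b]; apply: val_inj; rewrite /= ?rmorph1 ?rmorphM. Qed.

HB.instance Definition _ := GRing.isZmodMorphism.Build C (constants der) scalar_constant
  scalar_constant_is_zmod_morphism.
HB.instance Definition _ := GRing.isMonoidMorphism.Build C (constants der) scalar_constant
  scalar_constant_is_monoid_morphism.

Theorem planar_pencil N (u : nat -> S) n :
    (forall j, (j < N)%N -> total_degree_le n (u j)) ->
    (forall b : nat -> C, \sum_(j < N) (b j)%:P%:P * u j = 0 ->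
       forall j, (j < N)%N -> b j = 0) ->
    \det (\matrix_(i < N, j < N) iter i (plane_vf A B) (u j)) = 0 ->
  exists G1 G2, [/\ total_degree_le n G1, total_degree_le n G2, G2 != 0,
    forall c, G1 != c%:P%:P * G2
    & plane_vf A B G1 * G2 = G1 * plane_vf A B G2].
Proof.
apply: (@planar_pencil_over C (constants der) {fraction S} frac val scalar_constant A B
  (fracder (plane_vf A B))).
- by move=> s t /eqP; rewrite tofrac_eq => /eqP.
- move=> c; have [r [s [s0 ->]]] := fracE c; exists s; split=> //.
  by exists r; rewrite mulrC divfK // tofrac_eq0.
- by [].
- exact: der.
- by move=> s; rewrite fracder_tofrac //; apply: plane_vf_derivation.
- by move=> c; apply/eqP; apply: (valP c).
- by move=> f /eqP Df; exists (Sub f Df).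
Qed.

End Instantiation.

(** * Homogeneous polynomials and the chart z = 1 *)
Section Dehomogenisation.
Variable C : fieldType.
Local Notation S := {poly {poly C}}.
Local Notation M3 := {mpoly C[3]}.

Definition chart (i : 'I_3) : S := nth 1 [:: 'X%:P; 'X] i.

Definition deh : {rmorphism M3 -> S} := mmap (polyC \o polyC) chart.

Definition ix : 'I_3 := inord 0.
Definition iy : 'I_3 := inord 1.
Definition iz : 'I_3 := inord 2.

Lemma sum3 (V : nmodType) (f : 'I_3 -> V) : \sum_i f i = f ix + f iy + f iz.
Proof.
rewrite !big_ord_recr big_ord0 /= add0r; congr (f _ + f _ + f _);
  by apply: val_inj; rewrite /= inordK.
Qed.

Lemma deh_mono (m : 'X_{1..3}) : deh 'X_[m] = ('X^(m ix))%:P * 'X^(m iy).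
Proof.
rewrite /= mmapX /mmap1 !big_ord_recr big_ord0 /= mul1r /chart /=.
rewrite expr1n mulr1 -polyC_exp.
by congr ((_ ^+ m _)%:P * _ ^+ m _); apply: val_inj; rewrite /= inordK.
Qed.

Lemma deh_X (i : 'I_3) : deh 'X_i = chart i.
Proof. by rewrite /= mmapX mmap1U. Qed.

Lemma dehZ c (p : M3) : deh (c *: p) = c%:P%:P * deh p.
Proof. by rewrite /= mmapZ. Qed.

Lemma coef_deh_mono (m : 'X_{1..3}) i j :
  (deh 'X_[m])`_j`_i = ((m ix == i) && (m iy == j))%:R.
Proof.
rewrite deh_mono coefCM coefXn eq_sym -polyC_natr coefMC coefXn [i == _]eq_sym.
by rewrite -natrM mulnb.
Qed.

Lemma coef_deh (p : M3) i j : (deh p)`_j`_i =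
  \sum_(m <- msupp p) p@_m * ((m ix == i) && (m iy == j))%:R.
Proof.
rewrite {1}(mpolyE p) rmorph_sum !coef_sum; apply: eq_bigr => m _.
by rewrite dehZ !coefCM coef_deh_mono.
Qed.

Definition mon3 n i j : 'X_{1..3} :=
  [multinom nth 0%N [:: i; j; n - (i + j)]%N (k : 'I_3) | k < 3].

Lemma mon3P n i j (m : 'X_{1..3}) : mdeg m = n ->
  (m ix == i) && (m iy == j) = (i + j <= n)%N && (m == mon3 n i j).
Proof.
move=> mn; have mn3 : (m ix + m iy + m iz)%N = n by rewrite -mn mdegE sum3.
apply/andP/andP=> [[/eqP mi /eqP mj]|[ijn /eqP->]]; last first.
  by rewrite !mnmE /= !inordK.
split; first by rewrite -mn3 mi mj leq_addr.
apply/eqP/mnmP=> k; rewrite mnmE.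
have kE : k = inord k by rewrite inord_val.
move: mn3 mi mj; rewrite /ix /iy /iz => mn3 mi mj.
case: k kE => [[|[|[|]]]] //= _ ->; rewrite -?mi -?mj //.
by rewrite -mn3 addKn.
Qed.

Lemma coef_deh_homog n (p : M3) i j : p \is n.-homog ->
  (deh p)`_j`_i = if (i + j <= n)%N then p@_(mon3 n i j) else 0.
Proof.
move=> hp; rewrite coef_deh big_seq.
under eq_bigr => m mp do rewrite (mon3P _ _ (dhomog_mf hp mp)).
case: leqP => ijn /=; last by rewrite big1 // => m _; rewrite mulr0.
rewrite -big_seq; case: (boolP (mon3 n i j \in msupp p)) => pm.
  rewrite (big_rem _ pm) /= eqxx mulr1 big_seq big1 ?addr0 // => m.
  rewrite mem_rem_uniq ?msupp_uniq // inE => /andP[/negPf-> _].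
  by rewrite mulr0.
rewrite (memN_msupp_eq0 pm) big_seq big1 // => m mp.
by case: eqP => [mE|]; rewrite ?mulr0 // -mE mp in pm *.
Qed.

Lemma deh_total_degree_le n (p : M3) : p \is n.-homog -> total_degree_le n (deh p).
Proof. by move=> hp i j ij; rewrite (coef_deh_homog _ _ hp) leqNgt ij. Qed.

(** The degree being fixed, the exponents of x and y determine that of z. *)
Lemma deh_inj n (p : M3) : p \is n.-homog -> deh p = 0 -> p = 0.
Proof.
move=> hp dp; apply/mpolyP=> m; rewrite mcoeff0.
have [mp|/memN_msupp_eq0//] := boolP (m \in msupp p).
have mn := dhomog_mf hp mp.
have := mon3P (m ix) (m iy) mn; rewrite !eqxx => /esym/andP[le /eqP->].
by have := coef_deh_homog (m ix) (m iy) hp; rewrite le dp !coef0.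
Qed.

Definition homogenise n (g : S) : M3 :=
  \sum_(i < n.+1) \sum_(j < n.+1 | (i + j <= n)%N) g`_j`_i *: 'X_[mon3 n i j].

Lemma mdeg_mon3 n i j : (i + j <= n)%N -> mdeg (mon3 n i j) = n.
Proof.
by move=> ij; rewrite mdegE sum3 !mnmE !inordK //; apply: subnKC.
Qed.

Lemma homogenise_homog n g : homogenise n g \is n.-homog.
Proof.
apply: rpred_sum => i _; apply: rpred_sum => j ij; apply: rpredZ.
by rewrite dhomogX; apply/eqP/mdeg_mon3.
Qed.

Lemma deh_homogenise n g : total_degree_le n g -> deh (homogenise n g) = g.
Proof.
move=> tg; apply/polyP=> b; apply/polyP=> a.
rewrite (coef_deh_homog _ _ (homogenise_homog n g)).
case: leqP => abn; last by rewrite tg.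
have an : (a < n.+1)%N by rewrite ltnS (leq_trans _ abn) ?leq_addr.
have bn : (b < n.+1)%N by rewrite ltnS (leq_trans _ abn) ?leq_addl.
have monE i j : (i + j <= n)%N ->
    (mon3 n i j == mon3 n a b) = (i == a) && (j == b).
  move=> ij; have := mon3P a b (mdeg_mon3 ij); rewrite abn /= => <-.
  by rewrite !mnmE !inordK.
rewrite /homogenise raddf_sum (bigD1 (Ordinal an)) //= [X in _ + X]big1.
  rewrite addr0 raddf_sum (bigD1 (Ordinal bn)) //= [X in _ + X]big1.
    by rewrite addr0 mcoeffZ mcoeffX eqxx mulr1.
  move=> j /andP[ij jb]; rewrite mcoeffZ mcoeffX monE // eqxx /=.
  by rewrite -val_eqE /= in jb; rewrite (negPf jb) mulr0.
move=> i ia; rewrite raddf_sum big1 // => j ij; rewrite /= mcoeffZ mcoeffX monE //.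
by rewrite -val_eqE /= in ia; rewrite (negPf ia) mulr0.
Qed.

End Dehomogenisation.

Arguments deh {C}.

Section HomogeneousPolynomials.
Variable C : fieldType.
Local Notation M3 := {mpoly C[3]}.

Lemma deh_deriv0 (p : M3) : deh p^`M(ix) = map_poly (@deriv C) (deh p).
Proof.
elim/mpolyind: p => [|c m p _ _ IH]; first by rewrite !raddf0.
have derivXD (q r : {poly {poly C}}) : map_poly (@deriv C) (q + r)
    = map_poly (@deriv C) q + map_poly (@deriv C) r by exact: raddfD.
rewrite mderivD mderivZ mderivX !rmorphD !dehZ derivXD -IH; congr (_ + _).
have derivC_mul (a : {poly C}) k :
    map_poly (@deriv C) (a%:P * 'X^k) = a^`()%:P * 'X^k.
  apply/polyP=> j; rewrite coef_map_id0 ?deriv0 // !coefCM coefXn.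
  by case: eqP => _; rewrite ?mulr1 ?mulr0 ?deriv0.
rewrite !deh_mono !mulrA -!polyCM derivC_mul derivM derivC mul0r add0r derivXn.
rewrite !mnmBE !mnm1E eqxx -val_eqE /= !inordK //= subn0 subn1.
by rewrite (polyCM c) polyC_natr -mulrA mulr_natl.
Qed.

Lemma deh_deriv1 (p : M3) : deh p^`M(iy) = (deh p)^`().
Proof.
elim/mpolyind: p => [|c m p _ _ IH]; first by rewrite !raddf0.
rewrite mderivD mderivZ mderivX !rmorphD !dehZ derivD -IH; congr (_ + _).
rewrite !deh_mono !derivM !derivC !mul0r !add0r derivXn; congr (_ * _).
rewrite !mnmBE !mnm1E eqxx -val_eqE /= !inordK //= subn0 subn1.
by rewrite !polyC_natr mulr_natl mulrnAr.
Qed.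

Lemma euler n (p : M3) : p \is n.-homog ->
  \sum_(i < 3) 'X_i * p^`M(i) = n%:R *: p.
Proof.
move=> hp.
have monE i : 'X_i * p^`M(i) = \sum_(m <- msupp p) ((m i)%:R * p@_m) *: 'X_[m].
  rewrite {1}(mpolyE p) raddf_sum mulr_sumr; apply: eq_bigr => m _ /=.
  rewrite mderivZ mderivX -!scalerAr scalerA mulrC.
  have [->|mi] := posnP (m i); first by rewrite mul0r !scale0r.
  by rewrite -mpolyXD addmC submK // lep1mP -lt0n.
rewrite (eq_bigr _ (fun i _ => monE i)) exchange_big /=.
rewrite [p in RHS]mpolyE scaler_sumr [LHS]big_seq [RHS]big_seq.
apply: eq_bigr => m mp; rewrite -scaler_suml -mulr_suml -natr_sum scalerA.
by rewrite -(dhomog_mf hp mp) /= mdegE.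
Qed.

Lemma mderiv_homog n (p : M3) i : p \is n.-homog -> p^`M(i) \is n.-1.-homog.
Proof.
move=> hp; apply/dhomogP=> m; rewrite mcoeff_msupp mcoeff_mderiv => pm.
have mp : (m + U_(i))%MM \in msupp p.
  by rewrite mcoeff_msupp; apply: contraNneq pm => ->; rewrite mul0rn.
by rewrite -(dhomog_mf hp mp) /= mdegD mdeg1 addn1.
Qed.

End HomogeneousPolynomials.

(** * Extactic determinants of homogeneous vector fields *)
Section ExtacticCurve.
Variables (C : numClosedFieldType) (coef : 'I_3 -> {mpoly C[3]}) (vdeg : nat).
Hypothesis coef_homog : forall i, coef i \is vdeg.-homog.
Local Notation M3 := {mpoly C[3]}.
Local Notation S := {poly {poly C}}.

Definition fieldder (p : M3) : M3 := \sum_(i < 3) coef i * p^`M(i).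

Lemma fieldder_derivation : derivation fieldder.
Proof.
split=> [f g|f g]; last first.
  rewrite /fieldder mulr_suml mulr_sumr -big_split /=; apply: eq_bigr => i _.
  by rewrite mderivM; ring.
rewrite /fieldder -big_split; apply: eq_bigr => i _ /=.
by rewrite mderivD mulrDr.
Qed.

Lemma fieldder_homog n (p : M3) :
  p \is n.-homog -> fieldder p \is (vdeg + n.-1).-homog.
Proof.
move=> hp; apply: rpred_sum => i _.
by apply: dhomogM; [apply: coef_homog|apply: mderiv_homog].
Qed.

Let orbit_degree n l := iter l (fun m => vdeg + m.-1)%N n.

Lemma iter_fieldder_homog n l (p : M3) :
  p \is n.-homog -> iter l (fieldder) p \is (orbit_degree n l).-homog.
Proof. by move=> hp; elim: l => //= l IH; apply: fieldder_homog. Qed.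

(** The components on the chart z = 1 of the field z X - C R, where C is the
    last component of X and R is the radial field; its component along z is
    zero. *)
Definition chartA : S := deh (coef ix) - 'X%:P * deh (coef iz).
Definition chartB : S := deh (coef iy) - 'X * deh (coef iz).
Local Notation vf := (plane_vf chartA chartB).

(** By Euler's identity, R acts on forms of degree n as multiplication
    by n. *)
Lemma deh_fieldder n (p : M3) : p \is n.-homog ->
  vf (deh p) = deh (fieldder p) - n%:R%:P%:P * (deh (coef iz) * deh p).
Proof.
move=> hp; have := congr1 deh (euler hp); rewrite dehZ sum3 !rmorphD !rmorphM.
rewrite !deh_X deh_deriv0 deh_deriv1 mulrCA => <-.
rewrite /fieldder sum3 !rmorphD !rmorphM deh_deriv0 deh_deriv1.
rewrite /plane_vf /chartA /chartB /chart /= !inordK //=.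
move: (deh (coef ix)) (deh (coef iy)) (deh (coef iz)) => c0 c1 c2.
move: (map_poly _ _) (_^`()) (deh p^`M(iz)) => px py pz.
ring.
Qed.

(** The coefficients e do not depend on the form p: the degrees of the iterated
    derivatives of p, which enter through [deh_fieldder], depend on n only. *)
Lemma iter_chart n i : exists e : nat -> S, forall p : M3, p \is n.-homog ->
  iter i vf (deh p) = \sum_(l < i.+1) e l * deh (iter l (fieldder) p).
Proof.
have vf_der := plane_vf_derivation chartA chartB.
elim: i => [|i [e IH]].
  by exists (fun=> 1) => p hp; rewrite big_ord1 mul1r.
pose e1 l := if (l < i.+1)%N
  then vf (e l) - e l * ((orbit_degree n l)%:R%:P%:P * deh (coef iz)) else 0.
pose e2 l := if l is l'.+1 then e l' else 0.
exists (fun l => e1 l + e2 l) => p hp; rewrite iterS IH // (der_sum vf_der).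
transitivity (\sum_(l < i.+1) (e1 l * deh (iter l (fieldder) p)
    + e l * deh (iter l.+1 (fieldder) p))).
  apply: eq_bigr => l _; rewrite (derM vf_der) (deh_fieldder (iter_fieldder_homog l hp)).
  by rewrite /e1 ltn_ord iterS; ring.
under [RHS]eq_bigr => l _ do rewrite mulrDl.
have e1_top : e1 i.+1 = 0 by rewrite /e1 ltnn.
rewrite !big_split [X in _ = X + _]big_ord_recr /= e1_top mul0r addr0.
congr (_ + _).
by rewrite [RHS]big_ord_recl mul0r add0r.
Qed.

(** The matrix of the field on the chart is the product of a matrix of
    polynomials and the dehomogenised matrix of X. *)
Lemma det_chart n N (u : nat -> M3) : (forall j, u j \is n.-homog) ->
  \det (\matrix_(i < N, j < N) iter i (fieldder) (u j)) = 0 ->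
  \det (\matrix_(i < N, j < N) iter i vf (deh (u j))) = 0.
Proof.
move=> hu detu; have [e eP] := boolp.choice (iter_chart n).
set M := \matrix_(i, j) _ in detu.
have -> : \matrix_(i < N, j < N) iter i vf (deh (u j)) =
    (\matrix_(i < N, l < N) if (l <= i)%N then e i l else 0) *m map_mx deh M.
  apply/matrixP=> i j; rewrite !mxE eP //.
  rewrite (big_ord_widen N (fun l => e i l * deh (iter l (fieldder) (u j)))) //.
  rewrite big_mkcond; apply: eq_bigr => l _; rewrite !mxE ltnS.
  by case: ifP; rewrite ?mul0r.
by rewrite det_mulmx det_map_mx detu rmorph0 mulr0.
Qed.

Section Basis.
Variables (n N : nat) (v : N.-tuple (dhomog 3 C n)).
Hypothesis hv : basis_of {:dhomog 3 C n} v.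
Let u j : M3 := v`_j.

Lemma deh_basis_free (b : nat -> C) :
  \sum_(j < N) (b j)%:P%:P * deh (u j) = 0 -> forall j, (j < N)%N -> b j = 0.
Proof.
move=> bu j jN; have /freeP fv := basis_free hv.
apply: (fv (fun i => b i) _ (Ordinal jN)); apply: val_inj => /=.
rewrite raddf_sum; apply: (@deh_inj _ n).
  by apply: rpred_sum => i _; apply: dhomog_is_dhomog.
rewrite -[RHS]bu rmorph_sum; apply: eq_bigr => i _.
exact: dehZ.
Qed.

End Basis.

(** A first integral P / Q given by two forms of degree n that need not be
    coprime. *)
Definition pencil n (P Q : M3) := [/\ P \is n.-homog, Q \is n.-homog, Q != 0,
  forall c, P != c *: Q & fieldder P * Q = P * fieldder Q].

Lemma extactic0_pencil n N (v : N.-tuple (dhomog 3 C n)) :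
  basis_of {:dhomog 3 C n} v ->
  \det (\matrix_(i < N, j < N) iter i fieldder (tnth v j : M3)) = 0 ->
  exists P Q, pencil n P Q.
Proof.
move=> hv detv; have hu j : (v`_j : M3) \is n.-homog by apply: dhomog_is_dhomog.
have detu : \det (\matrix_(i < N, j < N) iter i fieldder (v`_j : M3)) = 0.
  rewrite -[RHS]detv; congr (\det _); apply/matrixP=> i j.
  by rewrite !mxE (tnth_nth 0).
have [G1 [G2 [t1 t2 G20 G12 GE]]] :=
  planar_pencil (fun j _ => deh_total_degree_le (hu j)) (deh_basis_free hv)
  (det_chart hu detu).
pose P := homogenise n G1; pose Q := homogenise n G2.
have [hP hQ] : P \is n.-homog /\ Q \is n.-homog.
  by split; apply: homogenise_homog.
have [dP dQ] : deh P = G1 /\ deh Q = G2 by split; apply: deh_homogenise.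
exists P, Q; split=> //.
- by apply: contraNneq G20 => Q0; rewrite -dQ Q0 rmorph0.
- by move=> c; apply: contraNneq (G12 c) => PQ; rewrite -dP -dQ PQ dehZ.
apply/eqP; rewrite -subr_eq0; apply/eqP; apply: (@deh_inj _ (vdeg + n.-1 + n)).
  apply: rpredB; first by apply: dhomogM => //; apply: fieldder_homog.
  by rewrite addnC; apply: dhomogM => //; apply: fieldder_homog.
(* The terms that come from the radial field cancel. *)
move: GE; rewrite -dP -dQ !(deh_fieldder (n := n)) // (rmorphB deh) !(rmorphM deh).
move: (deh (fieldder P)) (deh (fieldder Q)) (deh P) (deh Q) (deh (coef iz)) (_%:P%:P).
move=> xp xq p q c m E.
transitivity ((xp - m * (c * p)) * q - p * (xq - m * (c * q))); first by ring.
by rewrite E subrr.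
Qed.

(** Whether the derivative of a quotient vanishes depends only on the quotient;
    this is the denominator-free form. *)
Lemma cross_pencil (P Q P' Q' : M3) : Q != 0 -> P' * Q = P * Q' ->
  fieldder P * Q = P * fieldder Q -> fieldder P' * Q' = P' * fieldder Q'.
Proof.
move=> Q0 PQ' PQ; have vd := fieldder_derivation.
have := congr1 fieldder PQ'; rewrite !(derM vd).
move: (fieldder P) (fieldder Q) (fieldder P') (fieldder Q') PQ => p q p' q' PQ E.
apply: (mulIf Q0); apply: (mulIf Q0); apply/eqP; rewrite -subr_eq0; apply/eqP.
transitivity (Q * Q' * ((p' * Q + P' * q) - (p * Q' + P * q'))
  + Q' * Q' * (p * Q - P * q) - Q * q' * (P' * Q - P * Q')
  - Q' * q * (P' * Q - P * Q')); first by ring.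
by rewrite E PQ PQ' !subrr !mulr0 !addr0 !subr0.
Qed.

(** With P and Q raised to degree n by a power of z, the vector
    Q coord(P) - P coord(Q) is in the kernel of the matrix: its product with
    the i-th row is Q X^i(P) - P X^i(Q), which is zero by induction. *)
Lemma pencil_extactic0 n N (v : N.-tuple (dhomog 3 C n)) e P Q :
  basis_of {:dhomog 3 C n} v -> (e <= n)%N -> pencil e P Q ->
  \det (\matrix_(i < N, j < N) iter i fieldder (tnth v j : M3)) = 0.
Proof.
move=> hv en [hP hQ Q0 nPQ PQ]; have vd := fieldder_derivation.
pose z : M3 := 'X_iz ^+ (n - e).
have z0 : z != 0 by rewrite expf_neq0 // -msupp_eq0 msuppX.
have hz : z \is (n - e).-homog.
  rewrite -[(n - e)%N]mul1n; apply: dhomogMn; rewrite dhomogX; apply/eqP.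
  exact: mdeg1.
have [hP1 hQ1] : z * P \is n.-homog /\ z * Q \is n.-homog.
  by rewrite -(subnK en); split; apply: dhomogM.
pose P1 := DHomog hP1; pose Q1 := DHomog hQ1.
have zQ0 : z * Q != 0 by rewrite mulf_neq0.
have PQ1 : fieldder (z * P) * (z * Q) = z * P * fieldder (z * Q).
  by apply: (cross_pencil Q0 _ PQ); ring.
have iterPQ i : iter i fieldder (z * P) * (z * Q) = z * P * iter i fieldder (z * Q).
  elim: i => //= i IH; move: (z * P) (z * Q) zQ0 PQ1 IH => p q q0 pq.
  move: (iter i fieldder p) (iter i fieldder q) => a b ab.
  have := congr1 fieldder ab; rewrite !(derM vd) => E; apply: (mulIf q0).
  transitivity (q * (fieldder a * q + a * fieldder q) - fieldder q * (a * q)); first by ring.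
  rewrite E ab.
  transitivity (p * fieldder b * q + b * (fieldder p * q - p * fieldder q)); first by ring.
  by rewrite pq subrr mulr0 addr0.
have coordE (p : dhomog 3 C n) :
    (p : M3) = \sum_(j < N) (coord v j p)%:MP * (v`_j : M3).
  rewrite {1}(coord_basis hv (memvf p)) raddf_sum; apply: eq_bigr => j _.
  by rewrite mul_mpolyC.
have iterE i (p : dhomog 3 C n) : iter i fieldder (p : M3)
    = \sum_(j < N) (coord v j p)%:MP * iter i fieldder (v`_j : M3).
  elim: i => [|i IH]; first exact: coordE.
  rewrite iterS IH (der_sum vd); apply: eq_bigr => j _.
  rewrite (derM vd); have -> : fieldder (coord v j p)%:MP = 0.
    by rewrite /fieldder big1 // => l _; rewrite mderivC mulr0.
  by rewrite mul0r add0r.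
pose w j : M3 := z * Q * (coord v j P1)%:MP - z * P * (coord v j Q1)%:MP.
apply/eqP; rewrite -det_tr; apply/det0P; exists (\row_j w j).
  apply/negP=> /eqP/rowP w0.
  have {}w0 j : z * Q * (coord v j P1)%:MP = z * P * (coord v j Q1)%:MP.
    by apply/eqP; rewrite -subr_eq0; apply/eqP; have := w0 j; rewrite !mxE.
  have [j0 cj0] : exists j, coord v j Q1 != 0.
    apply: boolp.contrapT => nc; case/eqP: zQ0; rewrite -[LHS]/(Q1 : M3) coordE.
    rewrite big1 // => j _; have -> : coord v j Q1 = 0; last by rewrite mul0r.
    by apply/eqP; apply: contraT => cj; case: nc; exists j.
  case/eqP: (nPQ (coord v j0 P1 / coord v j0 Q1)).
  have := w0 j0; rewrite -!mulrA => /(mulfI z0).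
  rewrite ![_ * _%:MP]mulrC !mul_mpolyC => E.
  by rewrite mulrC -scalerA E scalerA mulVf // scale1r.
apply/rowP=> i; rewrite !mxE.
transitivity (z * Q * iter i fieldder (z * P) - z * P * iter i fieldder (z * Q)); last first.
  by rewrite -iterPQ mulrC subrr.
rewrite (iterE i P1) (iterE i Q1) !mulr_sumr -sumrB; apply: eq_bigr => j _.
by rewrite !mxE (tnth_nth 0) /w mulrBl !mulrA.
Qed.

Lemma pihomogM e (p q : M3) a : q \is e.-homog ->
  pihomog mdeg (a + e) (p * q) = pihomog mdeg a p * q.
Proof.
move=> hq; elim/mpolyind: p => [|c m p _ _ IH].
  by rewrite mul0r !raddf0 mul0r.
rewrite mulrDl !pihomogD mulrDl IH; congr (_ + _).
rewrite -scalerAl !linearZ /= -scalerAl; congr (_ *: _).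
have hm : 'X_[m] * q \is (mdeg m + e).-homog.
  by apply: dhomogM => //; rewrite dhomogX.
rewrite pihomogX; case: eqP => [ma|/eqP ma].
  by apply: pihomog_dE; rewrite -ma.
by rewrite mul0r; apply: pihomog_ne0 hm; rewrite eqn_add2r.
Qed.

(** If D is not constant, then Q' has a nonzero homogeneous component of some
    degree a < n.  As P' Q = P Q' with P and Q homogeneous, the components of
    degree a of P' and Q' have the same quotient as P and Q, against the
    minimality of n. *)
Lemma minimal_pencil_coprime n (P Q D P' Q' : M3) : pencil n P Q ->
  (forall m P1 Q1, pencil m P1 Q1 -> (n <= m)%N) ->
  P = D * P' -> Q = D * Q' -> D \is a GRing.unit.
Proof.
move=> [hP hQ Q0 nPQ PQ] nmin PD QD.
have /andP[D0 Q'0] : (D != 0) && (Q' != 0) by rewrite -negb_or -mulf_eq0 -QD.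
have [D1|D1] := leqP (msize D) 1.
  move: D0; rewrite (msize1_polyC D1) mpolyC_eq0 => D0.
  by apply: rmorph_unit; rewrite unitfE.
have [a aQ' a0] : exists2 a, (a < msize Q')%N & pihomog mdeg a Q' != 0.
  apply: boolp.contrapT => na; case/eqP: Q'0.
  rewrite (pihomog_partitionE (leqnn (msize Q'))) big1 // => a _.
  by apply/eqP; apply: contraT => a0; case: na; exists a.
have cross : pihomog mdeg a P' * Q = P * pihomog mdeg a Q'.
  rewrite [RHS]mulrC -!(@pihomogM n) //; congr (pihomog _ _ _).
  by rewrite PD QD; ring.
have : pencil a (pihomog mdeg a P') (pihomog mdeg a Q').
  split=> //; try exact: pihomogP; last exact: cross_pencil Q0 cross PQ.
  move=> c; apply: contraNneq (nPQ c) => cE; apply/eqP; apply: (mulIf a0).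
  by rewrite -cross cE -!scalerAl mulrC.
move/nmin; rewrite leqNgt => /negP[]; apply: leq_trans aQ' _.
have : (msize Q <= n.+1)%N.
  by rewrite msizeE; apply/bigmax_leqP_seq=> m mQ _; rewrite (dhomog_mf hQ mQ).
rewrite QD msizeM //; case: (msize D) D1 => [|[|s]] // _.
by rewrite !addSn /= ltnS => /(leq_trans _); apply; apply: leq_addl.
Qed.

End ExtacticCurve.

(** * First integrals *)
Section FirstIntegrals.
Variables (R : realType) (X : vfieldP2 R).
Local Notation C := (complex R).
Local Notation pencil := (pencil (coef X)).

Lemma first_integral_pencil e : has_first_integral X e ->
  exists P Q, pencil e P Q.
Proof.
case=> P [Q [[hP hQ Q0 _] [nconst]]]; rewrite vderF_frac // => /eqP.
rewrite mulf_eq0 invr_eq0 !tofrac_eq0 expf_eq0 (negPf Q0) andbF orbF subr_eq0.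
move=> /eqP PQ; exists P, Q; split=> // c; apply/eqP=> PcQ; case: nconst.
by exists c; rewrite PcQ -mul_mpolyC tofracM mulfK // tofrac_eq0.
Qed.

Lemma pencil_first_integral n P Q : pencil n P Q ->
  exists2 e, (e <= n)%N & has_first_integral X e.
Proof.
move=> pPQ; have [|e [P1 [Q1 p1]] emin] :=
  @min_witness (fun e => exists P Q, pencil e P Q).
  by exists n, P, Q.
exists e; first by apply: emin; exists P, Q.
have [hP hQ Q0 nPQ PQ] := p1; exists P1, Q1; split; [split=> //|split].
- move=> D P' Q'; apply: (minimal_pencil_coprime p1).
  by move=> m P2 Q2 p2; apply: emin; exists P2, Q2.
- case=> c PQc; have /eqP : P1%:F = (c%:MP)%:F * Q1%:F.
    by rewrite -PQc divfK // tofrac_eq0.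
  by rewrite -tofracM tofrac_eq mul_mpolyC (negPf (nPQ c)).
- rewrite vderF_frac //; have -> : vder X P1 * Q1 = P1 * vder X Q1.
    exact: PQ.
  by rewrite subrr tofrac0 mul0r.
Qed.

Lemma extactic_eq0P n (v : 'C(n + 2, 2).-tuple (dhomog 3 C n)) :
  basis_of {:dhomog 3 C n} v ->
  extactic X v = 0 <-> exists2 e, (e <= n)%N & has_first_integral X e.
Proof.
move=> hv; split=> [det0|[e en /first_integral_pencil[P [Q pPQ]]]].
  have [P [Q pPQ]] := extactic0_pencil (@coef_homog _ X) hv det0.
  exact: pencil_first_integral pPQ.
exact: (pencil_extactic0 hv en pPQ).
Qed.

End FirstIntegrals.

Theorem theorem1 (R : realType) (X : vfieldP2 R) (d : nat) (hd : (0 < d)%N)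
    (v : 'C(d + 2, 2).-tuple (dhomog 3 (complex R) d))
    (w : 'C(d.-1 + 2, 2).-tuple (dhomog 3 (complex R) d.-1))
    (hv : basis_of {:dhomog 3 (complex R) d} v)
    (hw : basis_of {:dhomog 3 (complex R) d.-1} w) :
  (has_first_integral X d /\
   (forall e : nat, (e < d)%N -> ~ has_first_integral X e)) <->
  (extactic X v = 0 /\ extactic X w <> 0).
Proof.
rewrite (extactic_eq0P X hv) (extactic_eq0P X hw).
have ltd e : (e <= d.-1)%N = (e < d)%N by rewrite -ltnS prednK.
split=> [[fd min]|[[e ed fe] min]].
  by split; [exists d|case=> e; rewrite ltd => /min].
have emin i : (i < d)%N -> ~ has_first_integral X i.
  by move=> id fi; apply: min; exists i; rewrite ?ltd.
split=> //; move: ed; rewrite leq_eqVlt => /predU1P[<-//|/emin].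
by case.
Qed.
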